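(* Let $N\ge 3$ and $\alpha>1/2$. Suppose that $u\in C^2(B_1(0)\setminus\{x_N=0\})\cap C^{0,\gamma}(\overline{B_1(0)})$ for some $0<\gamma<1$. If $-\mathrm{div}(|x_N|^{2\alpha}\nabla u)\ge 0$ weakly in $B_1(0)$ and $u$ is not constant in $B_1(0)$, then $u(x)>\min_{y\in\partial B_1(0)}u(y)$ for every $x\in B_1(0)$.
   Context: $x=(x_1,\dots,x_N)\in\mathbb{R}^N$; $B_1(0)$ is the open unit ball of $\mathbb{R}^N$ centered at the origin. ''$-\mathrm{div}(|x_N|^{2\alpha}\nabla u)\ge0$ weakly in $B_1(0)$'' means $\int_{B_1(0)}|x_N|^{2\alpha}\nabla u\cdot\nabla\varphi\,dx\ge 0$ for every $\varphi\in C_0^\infty(B_1(0))$ with $\varphi\ge 0$. *)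

(* Defs.v *)
From HB Require Import structures.
From mathcomp Require Import all_boot all_order all_algebra.
From mathcomp Require Import all_classical all_reals all_analysis.

Set Implicit Arguments.
Unset Strict Implicit.
Unset Printing Implicit Defensive.

Import Order.TTheory GRing.Theory Num.Theory.
Import numFieldNormedType.Exports.

Local Open Scope classical_set_scope.
Local Open Scope ring_scope.

(* The norm that the library puts on ['rV[R]_N] is the sup norm, hence an
   explicit Euclidean norm (the topologies agree). *)
Definition dotp (R : realType) (N : nat) (x y : 'rV[R]_N) : R :=
  \sum_(i < N) x ord0 i * y ord0 i.

Definition enorm (R : realType) (N : nat) (x : 'rV[R]_N) : R :=
  Num.sqrt (dotp x x).

Definition unit_ball (R : realType) (N : nat) : set 'rV[R]_N :=
  [set x | enorm x < 1].

Definition closed_unit_ball (R : realType) (N : nat) : set 'rV[R]_N :=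
  [set x | enorm x <= 1].

Definition unit_sphere (R : realType) (N : nat) : set 'rV[R]_N :=
  [set x | enorm x = 1].

Arguments unit_ball R N : clear implicits.
Arguments closed_unit_ball R N : clear implicits.
Arguments unit_sphere R N : clear implicits.

Definition evec (R : realType) (N : nat) (i : 'I_N) : 'rV[R]_N :=
  delta_mx ord0 i.

Definition partial (R : realType) (N : nat) (i : 'I_N) (f : 'rV[R]_N -> R) :
    'rV[R]_N -> R :=
  fun x => 'D_(evec R i) f x.

Definition grad (R : realType) (N : nat) (f : 'rV[R]_N -> R) (x : 'rV[R]_N) :
    'rV[R]_N :=
  \row_i partial i f x.

(* [C^k] on an open set [O]; [f] is a total function, but since [O] is open
   only its values on [O] matter. *)
Fixpoint Ck_on (R : realType) (N : nat) (k : nat) (O : set 'rV[R]_N)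
    (f : 'rV[R]_N -> R) {struct k} : Prop :=
  (forall x, O x -> {for x, continuous f}) /\
  if k is k'.+1 then
    forall i : 'I_N, (forall x, O x -> derivable f x (evec R i)) /\
                     Ck_on k' O (partial i f)
  else True.

(* [C_0^oo(O)]; a test function is identified with its extension by zero. *)
Definition test_function (R : realType) (N : nat) (O : set 'rV[R]_N)
    (phi : 'rV[R]_N -> R) : Prop :=
  [/\ forall k, Ck_on k setT phi,
      compact (closure [set x | phi x != 0])
    & closure [set x | phi x != 0] `<=` O].

Definition holder_on (R : realType) (N : nat) (gamma : R) (A : set 'rV[R]_N)
    (f : 'rV[R]_N -> R) : Prop :=
  exists C : R, forall x y, A x -> A y ->
    `|f x - f y| <= C * enorm (x - y) `^ gamma.

(* [measurableTypeR R] is [R] with its Borel sigma-algebra. *)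
Section cons_measure.
Context (R : realType) (n : nat)
  (mu : {sigma_finite_measure set (n.-tuple (measurableTypeR R)) -> \bar R}).

Definition cons_pair (p : measurableTypeR R * n.-tuple (measurableTypeR R)) :
    n.+1.-tuple (measurableTypeR R) :=
  [tuple of p.1 :: p.2].

Lemma measurable_cons_pair : measurable_fun setT cons_pair.
Proof. exact: measurable_cons. Qed.

Definition cons_measure : set (n.+1.-tuple (measurableTypeR R)) -> \bar R :=
  pushforward (lebesgue_measure \x mu)%E cons_pair.

Let cons_measureE :
  exists m : {measure set (n.+1.-tuple (measurableTypeR R)) -> \bar R},
    (m : set _ -> \bar R) = cons_measure.
Proof.
by exists (measure_function_pushforward__canonical__measure_function_Measure
  (lebesgue_measure \x mu)%E measurable_cons_pair).
Qed.

Let cons_measure0 : cons_measure set0 = 0%E.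
Proof. by have [m <-] := cons_measureE; exact: measure0. Qed.

Let cons_measure_ge0 A : (0 <= cons_measure A)%E.
Proof. by have [m <-] := cons_measureE; exact: measure_ge0. Qed.

Let cons_measure_sigma_additive : semi_sigma_additive cons_measure.
Proof.
by have [m <-] := cons_measureE; exact: measure_semi_sigma_additive.
Qed.

HB.instance Definition _ := isMeasure.Build _ _ _ cons_measure
  cons_measure0 cons_measure_ge0 cons_measure_sigma_additive.

Let cons_measure_sigma_finite : sigma_finite setT cons_measure.
Proof.
have [F TF Foo] : sigma_finite setT (lebesgue_measure \x mu)%E.
  have /sigma_finiteP[F [TF ndF Foo]] :=
    sigma_finiteT (@lebesgue_measure R : {sigma_finite_measure set _ -> \bar R}).
  have /sigma_finiteP[G [TG ndG Goo]] := sigma_finiteT mu.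
  exists (fun k => F k `*` G k).
    rewrite -setXTT TF TG predeqE => -[x y]; split.
      move=> [/= [i _ Fix] [k _ Gky]]; exists (maxn i k) => //; split.
      - by move: x Fix; exact/subsetPset/ndF/leq_maxl.
      - by move: y Gky; exact/subsetPset/ndG/leq_maxr.
    by move=> [i _ []/= ? ?]; split; exists i.
  move=> k; have [? ?] := Foo k; have [? ?] := Goo k.
  split; first exact: measurableX.
  by rewrite product_measure1E// lte_mul_pinfty// ge0_fin_numE.
pose un (t : n.+1.-tuple (measurableTypeR R)) :
    measurableTypeR R * n.-tuple (measurableTypeR R) :=
  (tnth t ord0, [tuple of behead t]).
have unK p : un (cons_pair p) = p.
  by case: p => x t; congr pair; apply/val_inj.
have mun : measurable_fun setT un.
  by apply/measurable_fun_pair; [exact: measurable_tnth|exact: measurable_behead].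
exists (fun k => un @^-1` F k).
  by rewrite -preimage_bigcup -TF preimage_setT.
move=> k; have [mF Fk] := Foo k; split.
  by rewrite -[X in measurable X]setTI; exact: mun.
rewrite /cons_measure /pushforward -comp_preimage.
by rewrite (_ : un \o cons_pair = id) //; apply/funext => p /=; rewrite unK.
Qed.

HB.instance Definition _ := Measure_isSigmaFinite.Build _ _ _
  cons_measure cons_measure_sigma_finite.

End cons_measure.

(* The library has Lebesgue measure on [R] only; on [R^n] it is the iterated
   product, transported along [R * R^n -> R^(n+1)]. *)
Fixpoint lebesgue_measure_n (R : realType) (n : nat) :
    {sigma_finite_measure set (n.-tuple (measurableTypeR R)) -> \bar R} :=
  match n return
    {sigma_finite_measure set (n.-tuple (measurableTypeR R)) -> \bar R} with
  | 0 => dirac [tuple]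
  | n'.+1 => cons_measure (lebesgue_measure_n R n')
  end.

Definition integral_Rn (R : realType) (N : nat) (D : set 'rV[R]_N)
    (f : 'rV[R]_N -> R) : \bar R :=
  let row_of (t : N.-tuple (measurableTypeR R)) : 'rV[R]_N :=
    \row_i tnth t i in
  (\int[lebesgue_measure_n R N]_(t in row_of @^-1` D) (f (row_of t))%:E)%E.

(* [x_N], where [N = n.+1]. *)
Definition last_coord (R : realType) (n : nat) (x : 'rV[R]_n.+1) : R :=
  x ord0 ord_max.

(* [- div (|x_N|^(2 alpha) grad u) >= 0] weakly in [O]. The integral is
   extended-real valued, and [+oo - oo = -oo], so that a test function whose
   integral is undefined violates the inequality. *)
Definition weak_supersolution (R : realType) (n : nat) (alpha : R)
    (O : set 'rV[R]_n.+1) (u : 'rV[R]_n.+1 -> R) : Prop :=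
  forall phi : 'rV[R]_n.+1 -> R,
    test_function O phi -> (forall x, 0 <= phi x) ->
    (0 <= integral_Rn O (fun x =>
       (`|last_coord x| `^ (2 * alpha) * dotp (grad u x) (grad phi x))%R))%E.

Definition is_min (R : realType) (T : Type) (f : T -> R) (A : set T) (m : R) :
    Prop :=
  (f @` A) m /\ lbound (f @` A) m.

(* Main.v *)
Require Import Defs.
From mathcomp Require Import all_boot all_order all_algebra.
From mathcomp Require Import all_classical all_reals all_analysis.
From mathcomp Require Import measurable_realfun ring lra.
Set Implicit Arguments.
Unset Strict Implicit.
Unset Printing Implicit Defensive.
Import Order.TTheory GRing.Theory Num.Theory.
Import numFieldNormedType.Exports.
Local Open Scope classical_set_scope.
Local Open Scope ring_scope.

(** Off the hyperplane [x_N = 0], testing the weak inequality against smooth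
bumps shows that it holds pointwise:
  [L u = Delta u + (2 alpha / x_N) d_N u <= 0]
([weak_supersolution_pointwise]).

Let [m] be the minimum of [u] over the closed ball.  The theorem amounts to the
strong minimum principle: if [u x0 = m] at a point of the open ball, then [u] is
constant in it.  Suppose that [p] is off the hyperplane and [u p > m].  On a
ball around [p], minus a small ball on which [u] stays above [m], and on the
side of the hyperplane where [p] lies, compare [u] with
  [m + eps (exp (- k |x - p|^2) - exp (- k rho)) + eta ln |x_N|].
For large [k] the exponential term is a subsolution of [L] there, the drift
[2 alpha / x_N] being harmless on that side.  The logarithm is what removes the
hyperplane from the boundary: it tends to [- oo] there, and
[L (ln |x_N|) = (2 alpha - 1) / x_N^2] is positive because [alpha > 1/2].  Hence
the difference has no interior minimum ([barrier_no_interior_min]), and making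
[eta] small gives a lower bound [u > m] ([hopf_lower_bound]), which passes to
the points of the hyperplane by continuity.

Consequently the value [m] spreads from [x0] to every [p] off the hyperplane,
not on the other side of it, with [|x0 - p| < 1 - |p|] ([min_propagates]): first
to points as close to the origin as desired, so to the origin itself
([min_at_origin]), which lies on the hyperplane and sees both sides; then in
small steps along every ray, and finally to the hyperplane by continuity
([strong_minimum_principle]). *)
(** * Measurability and integrability in coordinates *)

Definition row_of (R : realType) (n : nat)
    (t : n.-tuple (measurableTypeR R)) : 'rV[R]_n :=
  \row_i tnth t i.

Definition cube (R : realType) (n : nat) (c : 'rV[R]_n) (r : R) : set 'rV[R]_n :=
  [set x | forall i, `|x ord0 i - c ord0 i| <= r].

(** An open set is the union of the boxes with rational centre and rational
radius that it contains. *)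
Lemma open_measurable_row_of (R : realType) (n : nat) (O : set 'rV[R]_n) :
  open O -> measurable (@row_of R n @^-1` O).
Proof.
move=> oO.
pose box (p : 'rV[rat]_n * rat) : set (n.-tuple (measurableTypeR R)) :=
  \bigcap_(i in [set: 'I_n])
    (fun t => tnth t i) @^-1` (ball (ratr (p.1 ord0 i) : R) (ratr p.2 : R) : set R).
pose F (p : 'rV[rat]_n * rat) :=
  if `[< box p `<=` @row_of R n @^-1` O >] then box p else set0.
have -> : @row_of R n @^-1` O = \bigcup_p F p.
  apply/seteqP; split => [t /= Ot|t [p _]]; last first.
    by rewrite /F; case: asboolP => // sub; exact: sub.
  have /nbhs_ballP[e e0 eO] : nbhs (row_of t) O by exact: open_nbhs_nbhs.
  have [q /itvP qP] : exists q, ratr q \in `](0:R), (e / 2)[.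
    by apply: rat_in_itvoo; rewrite divr_gt0.
  have /choice[c cP] : forall i : 'I_n, exists c : rat,
      ratr c \in `](tnth t i - ratr q), (tnth t i + ratr q)[.
    move=> i; apply: rat_in_itvoo; rewrite ltrD2l gtrN //; by rewrite qP.
  exists (\row_i c i, q) => //.
  rewrite /F asboolT => [i _|s bs] /=.
    rewrite /box /= mxE -ball_normE /ball_ /=.
    by have := cP i; rewrite in_itv /= ltr_norml => /andP[? ?]; apply/andP; split; lra.
  apply: eO; split => // i j; rewrite (ord1 i) !mxE.
  have := bs j I; rewrite /= mxE -!ball_normE /ball_ /=.
  have := cP j; rewrite in_itv /= !ltr_norml => /andP[? ?] /andP[? ?].
  have : ratr q < e / 2 by rewrite qP.
  by move=> ?; apply/andP; split; lra.
apply: countable_bigcupT_measurable; first exact: countableP.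
move=> p; rewrite /F; case: ifP => // _.
apply: fin_bigcap_measurable => // i _.
rewrite -[X in measurable X]setTI.
apply: measurable_tnth => //; apply: open_measurable; exact: ball_open.
Qed.

Lemma continuous_measurable_row_of (R : realType) (n : nat) (f : 'rV[R]_n -> R) :
  continuous f -> measurable_fun setT (f \o @row_of R n).
Proof.
move=> cf; apply: (measurability _ (RGenOpens.measurableE R)) => //.
move=> _ [_ [a [b ->] <-]]; rewrite setTI comp_preimage.
apply: open_measurable_row_of; exact: open_comp (interval_open _ _).
Qed.

Lemma in_itv_norm (R : realType) (x c r : R) :
  (x \in `[c - r, c + r]) = (`|x - c| <= r).
Proof. by rewrite in_itv /= ler_norml; apply/andP/andP => -[? ?]; split; lra. Qed.

Lemma cube_compact (R : realType) (n : nat) (c : 'rV[R]_n) (r : R) :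
  compact (cube c r).
Proof.
rewrite (_ : cube c r = [set x | forall i, `[c ord0 i - r, c ord0 i + r]%classic (x ord0 i)]).
  apply: (@rV_compact _ _ (fun i => `[c ord0 i - r, c ord0 i + r]%classic)) => i.
  exact: segment_compact.
by apply/seteqP; split => x h i; have := h i; rewrite /= in_itv_norm.
Qed.

Lemma cube_measurable (R : realType) (n : nat) (c : 'rV[R]_n) (r : R) :
  measurable (@row_of R n @^-1` cube c r).
Proof.
rewrite (_ : _ @^-1` _ = \bigcap_(i in [set: 'I_n])
    (fun t => tnth t i) @^-1` `[c ord0 i - r, c ord0 i + r]%classic).
  apply: fin_bigcap_measurable => // i _.
  rewrite -[X in measurable X]setTI.
  by apply: measurable_tnth => //; exact: measurable_itv.
apply/seteqP; split => t /=.
  move=> h i _ /=; have := h i; rewrite mxE in_itv /= ler_norml => /andP[? ?].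
  by apply/andP; split; lra.
move=> h i; have := h i I; rewrite mxE /= in_itv /= ler_norml => /andP[? ?].
by apply/andP; split; lra.
Qed.

(** Induction on the dimension: the measure of a product set is the product of
the measures. *)
Lemma lebesgue_measure_cube (R : realType) (n : nat) (c : 'rV[R]_n) (r : R) :
  0 <= r ->
  lebesgue_measure_n R n (@row_of R n @^-1` cube c r) = ((r *+ 2) ^+ n)%:E.
Proof.
move=> r0; elim: n c => [|n IH] c.
  rewrite /= diracE expr0 mem_set //= => -[] //.
rewrite /= /cons_measure /pushforward.
rewrite (_ : _ @^-1` _ = `[c ord0 ord0 - r, c ord0 ord0 + r]%classic `*`
   (@row_of R n @^-1` cube (\row_i c ord0 (lift ord0 i)) r)).
  rewrite product_measure1E; [|exact: measurable_itv|exact: cube_measurable].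
  rewrite IH; have /= := lebesgue_measure_itv `[c ord0 ord0 - r, c ord0 ord0 + r].
  rewrite lte_fin => ->.
  case: ifPn => [_|]; first by rewrite -EFinD -EFinM exprS; congr (_ * _)%:E; lra.
  rewrite -leNgt => h; have -> : r = 0 by lra.
  by rewrite mul0rn mul0e expr0n.
apply/seteqP; split => -[x t] /=.
  move=> h; split; first by rewrite in_itv_norm; have := h ord0; rewrite mxE tnth0.
  by move=> i; have := h (lift ord0 i); rewrite !mxE tnthS.
move=> [+ h] i; rewrite in_itv_norm !mxE.
have [j ->|->] := unliftP ord0 i; first by have := h j; rewrite !mxE tnthS.
by rewrite tnth0.
Qed.

(** A continuous function vanishing off a cube is bounded, and the cube has
finite measure. *)
Lemma continuous_cube_integrable (R : realType) (n : nat) (c : 'rV[R]_n) (r : R)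
    (f : 'rV[R]_n -> R) :
  0 <= r -> continuous f -> (forall x, ~ cube c r x -> f x = 0) ->
  (lebesgue_measure_n R n).-integrable setT (EFin \o (f \o @row_of R n)).
Proof.
move=> r0 cf f0.
have mf := continuous_measurable_row_of cf.
have [M M0 fM] : exists2 M, 0 <= M & forall x, `|f x| <= M.
  have /compact_bounded[M [_ /(_ (`|M| + 1))]] : compact (f @` cube c r).
    by apply: continuous_compact; [exact: continuous_subspaceT|exact: cube_compact].
  have M1 : M < `|M| + 1 by rewrite (le_lt_trans (ler_norm _))// ltrDl.
  move=> /(_ M1) h; exists (`|M| + 1) => [|x]; first by rewrite addr_ge0.
  have [Kx|/f0 ->] := pselect (cube c r x); first by apply: h; exists x.
  by rewrite normr0 addr_ge0.
have mK := cube_measurable c r.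
rewrite (_ : EFin \o _ = (EFin \o (f \o @row_of R n)) \_ (@row_of R n @^-1` cube c r)).
  apply/(integrable_mkcond _ mK);
    apply: (@measurable_bounded_integrable _ _ _ _ (f \o @row_of R n)) => //.
  - by rewrite [X in (X < _)%E](lebesgue_measure_cube c r0) ltry.
  - exact: measurable_funTS.
  - exists M; split; first by rewrite num_real.
    by move=> B MB t _ /=; rewrite (le_trans (fM _))// ltW.
apply/funext => t; rewrite patchE; case: ifPn => // /negP; rewrite inE => h.
by rewrite /= f0.
Qed.

(** * Integrals of partial derivatives *)

(** Both derivatives are limits of the same difference quotients.  This covers
restrictions to a line as well as to a slice. *)
Lemma derivable_affine_comp (R : realType) (U V : normedModType R)
    (f : V -> R) (phi : U -> V) (a w : U) (v : V) :
  (forall h : R, phi (h *: w + a) = h *: v + phi a) ->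
  derivable (f \o phi) a w = derivable f (phi a) v
  /\ 'D_w (f \o phi) a = 'D_v f (phi a).
Proof.
move=> phiE; rewrite /derivable /derive.
suff -> : (fun h : R => h^-1 *: (((f \o phi) \o shift a) (h *: w) - (f \o phi) a))
  = (fun h : R => h^-1 *: ((f \o shift (phi a)) (h *: v) - f (phi a))) by [].
by apply/funext => h /=; rewrite phiE.
Qed.

Lemma continuous_rowP (R : realType) (T : topologicalType) (n : nat)
    (phi : T -> 'rV[R]_n) (a : T) :
  (forall i, {for a, continuous (fun x => phi x ord0 i)}) ->
  {for a, continuous phi}.
Proof.
move=> cphi; apply/cvg_ballP => e e0.
have : \forall x \near a, forall i, ball (phi a ord0 i) e (phi x ord0 i).
  apply: filter_forall => i.
  by have /cvg_ballP/(_ _ e0) := cphi i.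
by apply: filterS => x h; split => // i j; rewrite (ord1 i).
Qed.

(** The row counterpart of prefixing a tuple with one coordinate, which is how
the measure in dimension [n.+1] is built from the one in dimension [n]. *)
Definition scons (R : realType) (n : nat) (x : R) (y : 'rV[R]_n) : 'rV[R]_n.+1 :=
  \row_i oapp (fun j => y ord0 j) x (unlift ord0 i).

Lemma scons0 (R : realType) (n : nat) (x : R) (y : 'rV[R]_n) :
  scons x y ord0 ord0 = x.
Proof. by rewrite mxE unlift_none. Qed.

Lemma sconsS (R : realType) (n : nat) (x : R) (y : 'rV[R]_n) (j : 'I_n) :
  scons x y ord0 (lift ord0 j) = y ord0 j.
Proof. by rewrite mxE liftK. Qed.

Lemma row_of_cons (R : realType) (n : nat) (x : R)
    (t : n.-tuple (measurableTypeR R)) :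
  row_of (cons_pair (x, t)) = scons x (row_of t).
Proof.
apply/rowP => i; rewrite mxE; have [j ->|->] := unliftP ord0 i.
  by rewrite sconsS mxE tnthS.
by rewrite scons0 tnth0.
Qed.

Lemma scons_addl (R : realType) (n : nat) (x h : R) (y : 'rV[R]_n) :
  scons (h *: 1 + x) y = h *: evec R ord0 + scons x y.
Proof.
apply/rowP => i; have [j ->|->] := unliftP ord0 i.
  by rewrite !mxE !liftK /= mulr0 add0r.
by rewrite !mxE !unlift_none /=.
Qed.

Lemma scons_addr (R : realType) (n : nat) (x h : R) (y : 'rV[R]_n) (j : 'I_n) :
  scons x (h *: evec R j + y) = h *: evec R (lift ord0 j) + scons x y.
Proof.
apply/rowP => i; have [k ->|->] := unliftP ord0 i.
  by rewrite !mxE !liftK /= !mxE (inj_eq (@lift_inj _ _)).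
by rewrite !mxE !unlift_none /= mulr0 add0r.
Qed.

Lemma continuous_sconsl (R : realType) (n : nat) (y : 'rV[R]_n) :
  continuous (fun x : R => scons x y).
Proof.
move=> a; apply: continuous_rowP => i; have [j ->|->] := unliftP ord0 i.
  rewrite (_ : (fun x => _) = cst (y ord0 j)); first exact: cst_continuous.
  by apply/funext => x; rewrite sconsS.
rewrite (_ : (fun x => _) = id) //.
by apply/funext => x; rewrite scons0.
Qed.

Lemma continuous_sconsr (R : realType) (n : nat) (x : R) :
  continuous (fun y : 'rV[R]_n => scons x y).
Proof.
move=> a; apply: continuous_rowP => i; have [j ->|->] := unliftP ord0 i.
  rewrite (_ : (fun x => _) = (fun y : 'rV[R]_n => y ord0 j)).
    exact: coord_continuous.
  by apply/funext => y; rewrite sconsS.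
rewrite (_ : (fun x => _) = cst x); first exact: cst_continuous.
by apply/funext => y; rewrite scons0.
Qed.

Lemma cube_closed (R : realType) (n : nat) (c : 'rV[R]_n) (r : R) :
  closed (cube c r).
Proof.
rewrite (_ : cube c r = \bigcap_(i in [set: 'I_n])
    (fun x : 'rV[R]_n => x ord0 i) @^-1` [set` `[c ord0 i - r, c ord0 i + r]]).
  apply: closed_bigI => i _; apply: closed_comp; last exact: itv_closed.
  by move=> x _; exact: coord_continuous.
apply/seteqP; split => [x h i _|x h i]; have := h i; rewrite /= in_itv_norm //.
exact.
Qed.

(** [f] vanishes on the open complement of [K], hence so do its derivatives. *)
Lemma derive_off_closed (R : realType) (V : normedModType R) (K : set V)
    (f : V -> R) (x v : V) :
  closed K -> (forall y, ~ K y -> f y = 0) -> ~ K x -> 'D_v f x = 0.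
Proof.
move=> cK f0 Kx; rewrite (@near_eq_derive _ _ _ f (cst 0)) ?derive_cst //.
have : nbhs x (~` K) by apply: open_nbhs_nbhs; split => //; exact: closed_openC.
exact: filterS.
Qed.

Lemma integral_derive0 (R : realType) (g : R -> R) (a b : R) :
  a < b -> (forall x, derivable g x 1) -> continuous (fun x => 'D_1 g x) ->
  (forall x, ~ (a < x < b) -> g x = 0) ->
  (\int[lebesgue_measure]_x ('D_1 g x)%:E = 0)%E.
Proof.
move=> ab dg cg g0.
have cgg : continuous g.
  by move=> x; apply: differentiable_continuous; exact/derivable1_diffP.
have g'0 x : ~ (a <= x <= b) -> 'D_1 g x = 0.
  move=> nab; apply: (@derive_off_closed _ _ `[a, b]%classic) => //.
    exact: itv_closed.
  by move=> y /=; rewrite in_itv /= => nyb; apply: g0 => /andP[? ?]; apply: nyb;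
    rewrite !ltW.
rewrite (_ : (fun x => _) = (fun x => ('D_1 g x)%:E) \_ (`[a, b]%classic : set R)).
  rewrite -integral_mkcond (continuous_FTC2 ab (F := g)).
  - by rewrite !g0 ?sube0 // ltxx ?andbF.
  - exact: continuous_subspaceT.
  - by split => //; [apply: cvg_at_right_filter|apply: cvg_at_left_filter]; exact: cgg.
  - by move=> x _; rewrite derive1E.
apply/funext => x; rewrite patchE; case: ifPn => // /negP.
by rewrite inE /= in_itv /= => nab; rewrite g'0.
Qed.

(** Transporting an integral to the product space makes Fubini available. *)
Lemma integral_lebesgue_n_cons (R : realType) (n : nat)
    (f : n.+1.-tuple (measurableTypeR R) -> R) :
  measurable_fun setT f ->
  (lebesgue_measure_n R n.+1).-integrable setT (EFin \o f) ->
  (\int[lebesgue_measure_n R n.+1]_t (f t)%:E =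
   \int[lebesgue_measure \x lebesgue_measure_n R n]_p (f (cons_pair p))%:E)%E
  /\ (lebesgue_measure \x lebesgue_measure_n R n)%E.-integrable setT
       (EFin \o (f \o @cons_pair R n)).
Proof.
move=> mf If.
have mc := @measurable_cons_pair R n.
have mfE : measurable_fun setT (EFin \o f) by exact/measurable_EFinP.
have Ic : (lebesgue_measure \x lebesgue_measure_n R n)%E.-integrable setT
       (EFin \o (f \o @cons_pair R n)).
  apply/integrableP; split.
    by apply/measurable_EFinP; exact: measurableT_comp.
  have /integrableP[_] := If.
  rewrite (_ : (\int[lebesgue_measure_n R n.+1]_x _ = \int[pushforward
    (lebesgue_measure \x lebesgue_measure_n R n) (@cons_pair R n)]_x `|(EFin \o f) x|)%E) //.
  rewrite ge0_integral_pushforward //; exact: measurableT_comp.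
split => //.
rewrite (_ : (\int[lebesgue_measure_n R n.+1]_x _ = \int[pushforward
    (lebesgue_measure \x lebesgue_measure_n R n) (@cons_pair R n)]_x (EFin \o f) x)%E) //.
by rewrite (integral_pushforward mc).
Qed.

(** The divergence theorem without boundary term: Fubini reduces it to the
coordinate that is differentiated, where it is the fundamental theorem of
calculus. *)
Lemma integral_partial0 (R : realType) (n : nat) (i : 'I_n) (c : 'rV[R]_n)
    (r : R) (G : 'rV[R]_n -> R) :
  0 < r -> (forall x, derivable G x (evec R i)) -> continuous (partial i G) ->
  (forall x, ~ cube c r x -> G x = 0) ->
  (\int[lebesgue_measure_n R n]_t (partial i G (row_of t))%:E = 0)%E.
Proof.
move=> r0; elim: n i c G => [|n IH] i c G dG cG G0; first by case: i dG cG.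
have pG0 x : ~ cube c r x -> partial i G x = 0.
  by apply: derive_off_closed => //; exact: cube_closed.
have [-> Ip] := integral_lebesgue_n_cons (continuous_measurable_row_of cG)
  (continuous_cube_integrable (ltW r0) cG pG0).
(* Along a coordinate of the tail, the integral over the tail vanishes by
   induction for every head; along the head, the one-dimensional integral
   vanishes for every tail. *)
have [j ij|ij] := unliftP ord0 i.
  rewrite -(integral12_prod_meas1 Ip); apply: integral0_eq => x _.
  rewrite /fubini_F /=.
  under eq_integral do rewrite row_of_cons.
  have dj y := @derivable_affine_comp _ _ _ G (scons x) y (evec R j) (evec R i).
  have {}dj y : derivable (G \o scons x) y (evec R j) = derivable G (scons x y) (evec R i)
      /\ partial j (G \o scons x) y = partial i G (scons x y).
    by apply: dj => h; rewrite ij scons_addr.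
  under eq_integral do rewrite -(dj _).2.
  apply: (IH j (\row_k c ord0 (lift ord0 k))).
  - by move=> y; rewrite (dj y).1.
  - rewrite (_ : partial j _ = partial i G \o scons x).
      move=> y; apply: continuous_comp; [exact: continuous_sconsr|exact: cG].
    by apply/funext => y; rewrite (dj y).2.
  - move=> y Ky; apply: G0 => K; apply: Ky => k.
    by have := K (lift ord0 k); rewrite sconsS mxE.
rewrite -(integral21_prod_meas1 Ip); apply: integral0_eq => t _.
rewrite /fubini_G /=.
under eq_integral do rewrite row_of_cons.
set y := row_of t.
have d1 x : derivable (G \o (fun x => scons x y)) x 1 = derivable G (scons x y) (evec R i)
      /\ 'D_1 (G \o (fun x => scons x y)) x = partial i G (scons x y).
  by apply: (@derivable_affine_comp _ _ _ G (fun x => scons x y)) => h;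
    rewrite ij scons_addl.
under eq_integral do rewrite -(d1 _).2.
(* The radius is doubled to have the slice of the cube inside an open interval. *)
apply: (@integral_derive0 _ _ (c ord0 ord0 - (r + r)) (c ord0 ord0 + (r + r))).
- lra.
- by move=> x; rewrite (d1 x).1.
- rewrite (_ : (fun x => _) = partial i G \o (fun x => scons x y)).
    move=> x; apply: continuous_comp; [exact: continuous_sconsl|exact: cG].
  by apply/funext => x; rewrite (d1 x).2.
- move=> x nx /=; apply: G0 => K; apply: nx.
  have := K ord0; rewrite scons0 ler_norml => /andP[? ?].
  by apply/andP; split; lra.
Qed.

(** * Differentiation rules along lines *)

(** Every derivative along a vector is the derivative of a function of one real
variable, so that the one-variable theory (chain rule, mean value theorem)
applies to functions that are known only to have partial derivatives. *)
Lemma is_derive_lineP (R : realType) (V : normedModType R) (f : V -> R)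
    (x v : V) (s d : R) :
  is_derive s 1 (fun t : R => f (t *: v + x)) d <-> is_derive (s *: v + x) v f d.
Proof.
have [dE DE] : derivable (f \o (fun t : R => t *: v + x)) s 1 =
    derivable f (s *: v + x) v
    /\ 'D_1 (f \o (fun t : R => t *: v + x)) s = 'D_v f (s *: v + x).
  by apply: derivable_affine_comp => h; rewrite [h *: 1]mulr1 scalerDl addrA.
split=> -[df <-].
  by apply: DeriveDef; [rewrite -dE|rewrite -DE].
by apply: DeriveDef; [move: df; rewrite -dE|move: DE].
Qed.

Lemma is_derive_line0 (R : realType) (V : normedModType R) (f : V -> R)
    (x v : V) (d : R) :
  is_derive (0 : R) 1 (fun t : R => f (t *: v + x)) d <-> is_derive x v f d.
Proof. by have := is_derive_lineP f x v 0 d; rewrite scale0r add0r. Qed.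

Lemma is_derive_comp (R : realType) (V : normedModType R) (f : V -> R)
    (h : R -> R) (x v : V) (df dh : R) :
  is_derive (f x) 1 h dh -> is_derive x v f df ->
  is_derive x v (fun y => h (f y)) (dh * df).
Proof.
move=> hdh /is_derive_line0 fdf; apply/is_derive_line0.
have := @is_derive1_comp _ h (fun t : R => f (t *: v + x)) 0 dh df.
by rewrite scale0r add0r; apply.
Qed.

Lemma is_derive_mul (R : realType) (V : normedModType R) (f g : V -> R)
    (x v : V) (df dg : R) :
  is_derive x v f df -> is_derive x v g dg ->
  is_derive x v (fun y => f y * g y) (df * g x + f x * dg).
Proof.
move=> fdf gdg; have := is_deriveM fdf gdg.
by rewrite addrC /GRing.scale /= [g x * _]mulrC.
Qed.

Lemma is_derive_add (R : realType) (V : normedModType R) (f g : V -> R)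
    (x v : V) (df dg : R) :
  is_derive x v f df -> is_derive x v g dg ->
  is_derive x v (fun y => f y + g y) (df + dg).
Proof. exact: is_deriveD. Qed.

Lemma is_derive_inv (R : realType) (t : R) :
  t != 0 -> is_derive t 1 (fun s : R => s^-1) (- t ^- 2).
Proof.
move=> t0; apply: DeriveDef; first exact: derivableV.
by rewrite (@deriveV _ _ id) // derive_id /GRing.scale /= mulr1.
Qed.

Lemma is_derive_coord (R : realType) (n : nat) (i j : 'I_n) (x : 'rV[R]_n) :
  is_derive x (evec R j) (fun y : 'rV[R]_n => y ord0 i) (i == j)%:R.
Proof.
apply/is_derive_line0;
  rewrite (_ : (fun t => _) = (fun t : R => t * (i == j)%:R + x ord0 i)).
  by apply: is_derive_eq; rewrite scaler0 add0r addr0 /GRing.scale /= mulr1.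
by apply/funext => t; rewrite !mxE eqxx.
Qed.

(** * Smooth bump functions *)

(** Smooth functions of one variable that are flat at [0].  Allowing a polynomial
factor in [1/t] makes the family closed under differentiation, see
[is_derive_flat]. *)
Definition flat (R : realType) (p : {poly R}) (t : R) : R :=
  if 0 < t then p.[t^-1] * expR (- t^-1) else 0.

(** Quadratic flatness at [0], which yields differentiability there: the
exponential series bounds [s^(i+2) exp(-s)] by [(i+2)!] for [s = 1/t]. *)
Lemma flat_le_sqr (R : realType) (p : {poly R}) :
  exists2 C, 0 <= C & forall t, `|flat p t| <= C * t ^+ 2.
Proof.
exists (\sum_(i < size p) `|p`_i| * i.+2`!%:R).
  by apply: sumr_ge0 => i _; rewrite mulr_ge0.
move=> t; rewrite /flat; case: ifPn => [t0|_]; last first.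
  rewrite normr0 mulr_ge0 ?sqr_ge0 //.
  by apply: sumr_ge0 => i _; rewrite mulr_ge0.
rewrite normrM (ger0_norm (expR_ge0 _)) horner_coef.
have s0 : 0 < t^-1 by rewrite invr_gt0.
have -> : t = t^-1^-1 by rewrite invrK.
move: s0; move: (t^-1) => s s0. rewrite !invrK.
rewrite expRN exprVn ler_pdivlMr ?exprn_gt0 // mulrAC ler_pdivrMr ?expR_gt0 //.
apply: (@le_trans _ _ ((\sum_(i < size p) `|p`_i| * s ^+ i) * s ^+ 2)).
  apply: ler_wpM2r; first exact: exprn_ge0 (ltW s0).
  apply: le_trans (ler_norm_sum _ _ _) _; apply: ler_sum => i _.
  by rewrite normrM normrX (gtr0_norm s0).
rewrite !mulr_suml; apply: ler_sum => i _.
rewrite -!mulrA; apply: ler_wpM2l => //; rewrite -exprD addn2.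
have := expR_ge1Dxn i.+1 (ltW s0).
rewrite -ler_pdivrMl ?ltr0n ?fact_gt0 // mulrC; lra.
Qed.

Lemma is_derive_flat (R : realType) (p : {poly R}) (t : R) :
  is_derive t 1 (flat p) (flat ('X^2 * (p - p^`())) t).
Proof.
have [t0|t0|<-] := ltgtP 0 t.
- apply: (@near_eq_is_derive R R R (fun s => p.[s^-1] * expR (- s^-1))).
    near=> s; rewrite /flat ifT //; near: s; exact: lt_nbhsr.
  have dV := is_derive_inv (lt0r_neq0 t0).
  have dN : is_derive t 1 (fun s : R => - s^-1) (t ^- 2).
    by have := is_deriveN dV; rewrite opprK.
  have d1 := is_derive_comp (is_derive_poly p _) dV.
  have d2 := is_derive_comp (is_derive_expR _) dN.
  have d3 := is_derive_mul d1 d2.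
  have -> : flat ('X^2 * (p - p^`())) t = (p^`().[t^-1] * - t ^- 2 * expR (- t^-1) +
     p.[t^-1] * (expR (- t^-1) / t ^+ 2)).
    rewrite /flat t0 hornerM hornerXn hornerD hornerN; field; exact: lt0r_neq0.
  exact: d3.
- rewrite /flat ifF; last by apply/negbTE; rewrite -leNgt ltW.
  apply: (@near_eq_is_derive R R R (cst 0)).
  near=> s; rewrite ifF //; apply/negbTE; rewrite -leNgt ltW //.
  near: s; exact: lt_nbhsl.
- rewrite {2}/flat ltxx.
  have [C C0 fC] := flat_le_sqr p.
  have f0 : flat p 0 = 0 by rewrite /flat ltxx.
  (* The difference quotient at [0] is bounded by [C |h|]. *)
  have cvg0 : h^-1 *: ((flat p \o shift 0) (h *: 1) - flat p 0) @[h --> 0^'] --> (0 : R).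
    apply/cvgrPdist_le => e e0; near=> h.
    have h0 : h != 0 by near: h; exact: nbhs_dnbhs_neq.
    rewrite sub0r normrN f0 subr0 /= addr0 /GRing.scale /= mulr1 normrM normfV.
    rewrite mulrC ler_pdivrMr ?normr_gt0 // (le_trans (fC h)) //.
    rewrite -real_normK ?num_real // expr2 mulrA ler_wpM2r //.
    rewrite (@le_trans _ _ ((C + 1) * `|h|)) // ?ler_wpM2r ?lerDl //.
    rewrite mulrC -ler_pdivlMr ?ltr_wpDl //.
    near: h; apply: nbhs_dnbhs; apply/nbhs_ballP; exists (e / (C + 1)) => /=.
      by rewrite divr_gt0 // ltr_wpDl.
    by move=> y; rewrite -ball_normE /ball_ /= sub0r normrN => /ltW.
  apply: DeriveDef; first by apply/cvg_ex; exists 0.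
  exact: cvg_lim.
Unshelve. all: by end_near. Qed.

Lemma Ck_onW (R : realType) (n k : nat) (O : set 'rV[R]_n) (f : 'rV[R]_n -> R) :
  Ck_on k.+1 O f -> Ck_on k O f.
Proof.
elim: k f => [|k IH] f [cf df]; split => // i.
by have [df1 df2] := df i; split => //; exact: IH.
Qed.

Lemma Ck_on_cst (R : realType) (n k : nat) (a : R) :
  Ck_on k [set: 'rV[R]_n] (fun=> a).
Proof.
elim: k a => [|k IH] a; (split; first by move=> x _; exact: cst_continuous) => // i.
split=> [x _|]; first exact: derivable_cst.
by rewrite (_ : partial i _ = fun=> 0) //; apply/funext => x; exact: derive_cst.
Qed.

Lemma Ck_on_add (R : realType) (n k : nat) (f g : 'rV[R]_n -> R) :
  Ck_on k setT f -> Ck_on k setT g -> Ck_on k setT (fun x => f x + g x).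
Proof.
elim: k f g => [|k IH] f g [cf df] [cg dg];
  (split; first by move=> x _; apply: continuousD; [exact: cf|exact: cg]) => // i.
have [df1 df2] := df i; have [dg1 dg2] := dg i; split.
  by move=> x _; apply: derivableD; [exact: df1|exact: dg1].
rewrite (_ : partial i _ = fun x => partial i f x + partial i g x); first exact: IH.
by apply/funext => x; apply: deriveD; [exact: df1|exact: dg1].
Qed.

(** By the Leibniz rule, a partial derivative of the product is a sum of products
of functions of class [C^k]. *)
Lemma Ck_on_mul (R : realType) (n k : nat) (f g : 'rV[R]_n -> R) :
  Ck_on k setT f -> Ck_on k setT g -> Ck_on k setT (fun x => f x * g x).
Proof.
elim: k f g => [|k IH] f g Cf Cg; have [cf df] := Cf; have [cg dg] := Cg;
  (split; first by move=> x _; apply: continuousM; [exact: cf|exact: cg]) => // i.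
have [df1 df2] := df i; have [dg1 dg2] := dg i.
have dfg x : is_derive x (evec R i) (fun x => f x * g x)
    (partial i f x * g x + f x * partial i g x).
  by apply: is_derive_mul; apply: derivableP; [exact: df1|exact: dg1].
split=> [x _|]; first by have [] := dfg x.
rewrite (_ : partial i _ = fun x => partial i f x * g x + f x * partial i g x).
  by apply: Ck_on_add; apply: IH => //; exact: Ck_onW.
by apply/funext => x; have [_ <-] := dfg x.
Qed.

Lemma Ck_on_prod (R : realType) (n k : nat) (I : Type) (s : seq I)
    (F : I -> 'rV[R]_n -> R) :
  (forall i, Ck_on k setT (F i)) ->
  Ck_on k setT (fun x => \prod_(i <- s) F i x).
Proof.
move=> CF; elim: s => [|i s IH].
  rewrite (_ : (fun x => _) = fun=> 1); first exact: Ck_on_cst.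
  by apply/funext => x; rewrite big_nil.
rewrite (_ : (fun x => _) = fun x => F i x * \prod_(j <- s) F j x).
  exact: Ck_on_mul.
by apply/funext => x; rewrite big_cons.
Qed.

(** Differentiation only replaces [p] by ['X^2 * (p - p^`())], so that an
induction on [k] over all [p] at once succeeds. *)
Lemma Ck_on_flat (R : realType) (n k : nat) (i : 'I_n) (a b : R) (p : {poly R}) :
  Ck_on k setT (fun x : 'rV[R]_n => flat p (a * x ord0 i + b)).
Proof.
have cflat q : continuous (flat q).
  by move=> t; apply: differentiable_continuous; apply/derivable1_diffP;
    have [] := is_derive_flat q t.
elim: k p => [|k IH] p; (split; first (move=> x _;
    apply: (@continuous_comp _ _ _ (fun x : 'rV[R]_n => a * x ord0 i + b) (flat p));
      [|exact: cflat];
    apply: (@continuousD _ _ _ (fun x : 'rV[R]_n => a * x ord0 i));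
      [|exact: cst_continuous];
    apply: (@continuousM _ _ (cst a));
      [exact: cst_continuous|exact: coord_continuous])) => // j.
have da (x : 'rV[R]_n) : is_derive x (evec R j) (fun y : 'rV[R]_n => a * y ord0 i + b) (a * (i == j)%:R).
  have := is_derive_add (is_derive_mul (is_derive_cst a x (evec R j)) (is_derive_coord i j x))
      (is_derive_cst b x (evec R j)).
  by rewrite mul0r add0r addr0.
have dp x := is_derive_comp (is_derive_flat p _) (da x).
split=> [x _|]; first by have [] := dp x.
rewrite (_ : partial j _ = fun x => flat ('X^2 * (p - p^`())) (a * x ord0 i + b) * (a * (i == j)%:R)).
  by apply: Ck_on_mul; [exact: IH|exact: Ck_on_cst].
by apply/funext => x; have [_ <-] := dp x.
Qed.

(** In each coordinate the product is nonzero exactly where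
[`|x_i - c_i| < r]; the affine arguments are written in the form to which
[Ck_on_flat] applies. *)
Definition bump (R : realType) (n : nat) (c : 'rV[R]_n) (r : R) (x : 'rV[R]_n) : R :=
  \prod_(i < n) (flat 1 (1 * x ord0 i + (r - c ord0 i)) *
                 flat 1 (-1 * x ord0 i + (r + c ord0 i))).

Lemma flat1_gt0 (R : realType) (t : R) : (0 < flat 1 t) = (0 < t).
Proof. by rewrite /flat; case: ifP; rewrite ?ltxx // hornerE mul1r expR_gt0. Qed.

Lemma flat1_ge0 (R : realType) (t : R) : 0 <= flat 1 t.
Proof. by rewrite /flat; case: ifP => //; rewrite hornerE mul1r expR_ge0. Qed.

Lemma bump_ge0 (R : realType) (n : nat) (c : 'rV[R]_n) (r : R) (x : 'rV[R]_n) :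
  0 <= bump c r x.
Proof. by apply: prodr_ge0 => i _; rewrite mulr_ge0 ?flat1_ge0. Qed.

Lemma bump_gt0 (R : realType) (n : nat) (c : 'rV[R]_n) (r : R) (x : 'rV[R]_n) :
  (forall i, `|x ord0 i - c ord0 i| < r) -> 0 < bump c r x.
Proof.
move=> xc; apply: prodr_gt0 => i _; have := xc i; rewrite ltr_norml => /andP[? ?].
by rewrite mulr_gt0 // flat1_gt0; lra.
Qed.

Lemma bump_eq0 (R : realType) (n : nat) (c : 'rV[R]_n) (r : R) (x : 'rV[R]_n) :
  ~ cube c r x -> bump c r x = 0.
Proof.
move=> /existsNP[i /negP]; rewrite -ltNge => xc; apply/eqP/prodf_eq0.
exists i => //; rewrite mulf_eq0; move: xc; rewrite ltr_normr => /orP[] h.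
  by apply/orP; right; rewrite /flat ifF //; apply/negbTE; rewrite -leNgt; lra.
by apply/orP; left; rewrite /flat ifF //; apply/negbTE; rewrite -leNgt; lra.
Qed.

Lemma bump_test_function (R : realType) (n : nat) (O : set 'rV[R]_n)
    (c : 'rV[R]_n) (r : R) :
  cube c r `<=` O -> test_function O (bump c r).
Proof.
move=> KO.
have sK : closure [set x | bump c r x != 0] `<=` cube c r.
  rewrite closureE => x; apply; split; first exact: cube_closed.
  by move=> y /= /eqP y0; apply: contrapT => /bump_eq0.
split.
- by move=> k; apply: Ck_on_prod => i; apply: Ck_on_mul; exact: Ck_on_flat.
- by apply: subclosed_compact sK => //; [exact: closed_closure|exact: cube_compact].
- exact: subset_trans sK KO.
Qed.

(** * The pointwise differential inequality *)

(** The absolute value lets a single formula serve on both sides of the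
hyperplane. *)
Lemma is_derive_ln_norm (R : realType) (s : R) :
  s != 0 -> is_derive s 1 (fun t : R => ln `|t|) s^-1.
Proof.
move=> s0; have [s_lt0|s_gt0|/eqP] := ltgtP s 0; last by rewrite (negbTE s0).
  apply: (@near_eq_is_derive R R R (fun t => ln (- t))).
    by near=> t; rewrite ltr0_norm //; near: t; exact: lt_nbhsl.
  have dN : is_derive s 1 (fun t : R => - t) (-1) by apply: is_deriveN.
  have Ns_gt0 : 0 < - s by rewrite oppr_gt0.
  have := is_derive_comp (is_derive1_ln Ns_gt0) dN.
  by rewrite mulrN1 invrN opprK.
apply: (@near_eq_is_derive R R R (fun t => ln t)).
  by near=> t; rewrite gtr0_norm //; near: t; exact: lt_nbhsr.
exact: is_derive1_ln.
Unshelve. all: by end_near. Qed.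

Lemma is_derive_powR_norm (R : realType) (a s : R) :
  s != 0 -> is_derive s 1 (fun t : R => `|t| `^ a) (a / s * `|s| `^ a).
Proof.
move=> s0.
have pE (t : R) : t != 0 -> `|t| `^ a = expR (a * ln `|t|).
  by move=> t0; rewrite /powR normr_eq0 (negbTE t0).
apply: (@near_eq_is_derive R R R (fun t => expR (a * ln `|t|))).
  near=> t; rewrite pE //; near: t.
  by have := @open_neq R 0; rewrite openE => /(_ s s0).
have d1 := is_derive_mul (is_derive_cst a s 1) (is_derive_ln_norm s0).
have := is_derive_comp (is_derive_expR _) d1.
by rewrite /cst mul0r add0r pE // mulrC.
Unshelve. all: by end_near. Qed.

Lemma is_derive_continuous (R : realType) (f : R -> R) (s d : R) :
  is_derive s 1 f d -> {for s, continuous f}.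
Proof.
by case=> df _; apply: differentiable_continuous; exact/derivable1_diffP.
Qed.

Lemma continuous_sum_at (R : realType) (T : topologicalType) (I : Type)
    (s : seq I) (F : I -> T -> R) (x : T) :
  (forall i, {for x, continuous (F i)}) ->
  {for x, continuous (fun y => \sum_(i <- s) F i y)}.
Proof.
by move=> cF; apply: cvg_big => [|i _]; [exact: add_continuous|exact: cF].
Qed.

Lemma dotp_continuous (R : realType) (n : nat) :
  continuous (fun x : 'rV[R]_n => dotp x x).
Proof.
move=> x; apply: continuous_sum_at => i.
by apply: (@continuousM _ _ (fun x : 'rV[R]_n => x ord0 i)); exact: coord_continuous.
Qed.

Lemma enorm_continuous (R : realType) (n : nat) :
  continuous (@enorm R n).
Proof.
move=> x; apply: (@continuous_comp _ _ _ (fun x : 'rV[R]_n => dotp x x)).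
  exact: dotp_continuous.
exact: sqrt_continuous.
Qed.

Lemma last_coord_continuous (R : realType) (n : nat) :
  continuous (@last_coord R n).
Proof. by move=> x; exact: coord_continuous. Qed.

Lemma open_unit_ball (R : realType) (n : nat) : open (unit_ball R n).
Proof.
rewrite (_ : unit_ball R n = @enorm R n @^-1` [set t | t < 1]) //.
by apply: open_comp; [move=> x _; exact: enorm_continuous|exact: open_lt].
Qed.

Lemma open_split_ball (R : realType) (n : nat) :
  open (unit_ball R n.+1 `\` [set x | last_coord x = 0]).
Proof.
rewrite setDE; apply: openI; first exact: open_unit_ball.
rewrite (_ : ~` _ = @last_coord R n @^-1` [set t | t != 0]); last first.
  by apply/seteqP; split => x /= /eqP.
by apply: open_comp; [move=> x _; exact: last_coord_continuous|exact: open_neq].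
Qed.

(** Meant for functions multiplied by a bump, about which nothing is known off
[O] except that they vanish. *)
Lemma continuous_extension0 (R : realType) (n : nat) (K O : set 'rV[R]_n)
    (f : 'rV[R]_n -> R) :
  closed K -> K `<=` O -> (forall x, ~ K x -> f x = 0) ->
  (forall x, O x -> {for x, continuous f}) -> continuous f.
Proof.
move=> cK KO f0 cf x; have [/KO/cf //|Kx] := pselect (K x).
have : nbhs x (~` K) by apply: open_nbhs_nbhs; split => //; exact: closed_openC.
move=> nK; rewrite /continuous_at f0 //; apply: cvg_near_cst.
  exact: nbhs_filter.
by apply: filterS nK => y Ky; rewrite f0.
Qed.

(** By continuity [f] is at least [f x / 2] on a small cube around [x], and
cubes have positive measure. *)
Lemma integral_cube_gt0 (R : realType) (n : nat) (c : 'rV[R]_n) (r : R)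
    (f : 'rV[R]_n -> R) (x : 'rV[R]_n) :
  0 <= r -> continuous f -> (forall y, ~ cube c r y -> f y = 0) ->
  (forall y, 0 <= f y) -> 0 < f x ->
  (0 < \int[lebesgue_measure_n R n]_t (f (row_of t))%:E)%E.
Proof.
move=> r0 cf f0 fge0 fx.
have : \forall y \near x, f x / 2 < f y.
  by have /cvgr_gt := cf x; apply; rewrite ltr_pdivrMr // mulr_natr mulr2n ltrDl.
move=> /nbhs_ballP[e e0 eP].
pose K := @row_of R n @^-1` cube x (e / 2).
have mK : measurable K by exact: cube_measurable.
have e2 : 0 <= e / 2 by rewrite divr_ge0 // ltW.
apply: (@lt_le_trans _ _ (\int[lebesgue_measure_n R n]_(t in K) (f x / 2)%:E)%E).
  rewrite integral_cst // [X in (_ * X)%E](lebesgue_measure_cube x e2).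
  by rewrite -EFinM lte_fin mulr_gt0 ?divr_gt0 // exprn_gt0 // pmulrn_lgt0 // divr_gt0.
rewrite [leLHS]integral_mkcond.
apply: ge0_le_integral => //.
- by move=> t _; rewrite patchE; case: ifP => // _; rewrite lee_fin divr_ge0 // ltW.
- apply/(measurable_restrictT _ mK); exact: measurable_cst.
- by apply/measurable_EFinP; exact: (continuous_measurable_row_of cf).
- move=> t _; rewrite patchE; case: ifPn => [/set_mem Kt|_]; last by rewrite lee_fin.
  rewrite lee_fin ltW //; apply: eP; split => // i j;
    rewrite (ord1 i) -ball_normE /ball_ /=.
  by rewrite distrC (le_lt_trans (Kt j)) // ltr_pdivrMr // mulr_natr mulr2n ltrDl.
Qed.

(** The operator [div (|x_N|^(2 alpha) grad u)] divided by its weight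
[|x_N|^(2 alpha)], expanded off the hyperplane. *)
Definition weighted_laplacian (R : realType) (n : nat) (alpha : R)
    (u : 'rV[R]_n.+1 -> R) (x : 'rV[R]_n.+1) : R :=
  \sum_(i < n.+1) partial i (partial i u) x
  + 2 * alpha / last_coord x * partial ord_max u x.

Section pointwise.
Variables (R : realType) (n : nat) (alpha : R) (u : 'rV[R]_n.+1 -> R).
Let O : set 'rV[R]_n.+1 := unit_ball R n.+1 `\` [set x | last_coord x = 0].
Hypothesis C2u : Ck_on 2 O u.

Let w (x : 'rV[R]_n.+1) : R := `|last_coord x| `^ (2 * alpha).

Lemma Ck2_partial i x : O x -> is_derive x (evec R i) u (partial i u x).
Proof. by have [_ /(_ i)[du _]] := C2u; move=> Ox; apply/derivableP/du. Qed.

Lemma Ck2_partial2 i j x :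
  O x -> is_derive x (evec R j) (partial i u) (partial j (partial i u) x).
Proof.
have [_ /(_ i)[_ [_ /(_ j)[du _]]]] := C2u.
by move=> Ox; apply/derivableP/du.
Qed.

Lemma Ck2_continuous_partial i x : O x -> {for x, continuous (partial i u)}.
Proof. by have [_ /(_ i)[_ [cu _]]] := C2u; exact: cu. Qed.

Lemma Ck2_continuous_partial2 i j x :
  O x -> {for x, continuous (partial j (partial i u))}.
Proof. by have [_ /(_ i)[_ [_ /(_ j)[_ [cu _]]]]] := C2u; exact: cu. Qed.

Let last_neq0 x : O x -> last_coord x != 0.
Proof. by case=> _ /eqP. Qed.

Let w_continuous x : O x -> {for x, continuous w}.
Proof.
move=> /last_neq0 x0;
  apply: (@continuous_comp _ _ _ (@last_coord R n) (fun t => `|t| `^ (2 * alpha))).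
  exact: last_coord_continuous.
exact: is_derive_continuous (is_derive_powR_norm _ x0).
Qed.

Let is_derive_w i x : O x ->
  is_derive x (evec R i) w (2 * alpha / last_coord x * w x * (ord_max == i)%:R).
Proof.
move=> /last_neq0 x0.
exact: (is_derive_comp (is_derive_powR_norm (2 * alpha) x0) (is_derive_coord ord_max i x)).
Qed.

Let last_inv_continuous x : O x -> {for x, continuous (fun y => 2 * alpha / last_coord y)}.
Proof.
move=> /last_neq0 x0; apply: continuousM; first exact: cst_continuous.
apply: continuousV => //; exact: last_coord_continuous.
Qed.

Lemma weighted_laplacian_continuous x : O x ->
  {for x, continuous (weighted_laplacian alpha u)}.
Proof.
move=> Ox; apply: continuousD.
  by apply: continuous_sum_at => i; exact: Ck2_continuous_partial2.
by apply: continuousM; [exact: last_inv_continuous|exact: Ck2_continuous_partial].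
Qed.

(** If the operator were positive at [x], it would be so on a cube around [x]
away from the hyperplane.  For a bump [phi] on that cube,
[w grad u . grad phi] is the divergence of the field [w phi grad u], whose
integral vanishes, minus [w phi L u], whose integral is positive: the weak
inequality fails for [phi]. *)
Lemma weak_supersolution_pointwise x :
  weak_supersolution alpha (unit_ball R n.+1) u -> O x ->
  weighted_laplacian alpha u x <= 0.
Proof.
move=> weak Ox; rewrite leNgt; apply/negP => Lx.
have oO : open O by exact: open_split_ball.
have : \forall y \near x, O y /\ 0 < weighted_laplacian alpha u y.
  apply: filterI; first exact: open_nbhs_nbhs.
  by have /cvgr_gt := weighted_laplacian_continuous Ox; exact.
move=> /nbhs_ballP[e /= e0 eP].
pose r := e / 2; have r0 : 0 < r by rewrite divr_gt0.
pose K := cube x r; have cK : closed K := @cube_closed _ _ x r.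
have KP y : K y -> O y /\ 0 < weighted_laplacian alpha u y.
  move=> Ky; apply: eP; split => // i j; rewrite (ord1 i) -ball_normE /ball_ /=.
  by rewrite distrC (le_lt_trans (Ky j)) // ltr_pdivrMr // mulr_natr mulr2n ltrDl.
have KO : K `<=` O by move=> y /KP[].
have KB : K `<=` unit_ball R n.+1 by move=> y /KO[].
pose phi := bump x r.
have [Ckphi _ _] : test_function O phi by exact: bump_test_function.
have phi0 y : ~ K y -> phi y = 0 by exact: bump_eq0.
have cphi : continuous phi by move=> y; have [cp _] := Ckphi 0%N; exact: cp.
have dphi i y : is_derive y (evec R i) phi (partial i phi y).
  by have [_ /(_ i)[dp _]] := Ckphi 1%N; apply/derivableP/dp.
have cdphi i : continuous (partial i phi).
  by move=> y; have [_ /(_ i)[_ [cp _]]] := Ckphi 1%N; exact: cp.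
have dphi0 i y : ~ K y -> partial i phi y = 0 by exact: derive_off_closed.
(* The [i]-th component of [w phi grad u]: it vanishes off [K], so that its
   behaviour on the hyperplane does not matter. *)
pose G i y := w y * partial i u y * phi y.
have G0 i y : ~ K y -> G i y = 0 by move=> Ky; rewrite /G phi0 // mulr0.
pose dG i y := (2 * alpha / last_coord y * w y * (ord_max == i)%:R * partial i u y
   + w y * partial i (partial i u) y) * phi y + w y * partial i u y * partial i phi y.
have G'O i y : O y -> is_derive y (evec R i) (G i) (dG i y).
  move=> Oy; apply: is_derive_mul (dphi i y).
  exact: is_derive_mul (is_derive_w i Oy) (Ck2_partial2 i i Oy).
have dG0 i y : ~ K y -> dG i y = 0.
  by move=> Ky; rewrite /dG phi0 // dphi0 // !mulr0 addr0.
have G'E i : partial i (G i) = dG i.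
  apply/funext => y; have [/KO Oy|Ky] := pselect (K y).
    by have [_ <-] := G'O i y Oy.
  by rewrite dG0 //; exact: (derive_off_closed _ cK (G0 i) Ky).
have derG i y : derivable (G i) y (evec R i).
  have [/KO Oy|Ky] := pselect (K y); first by have [] := G'O i y Oy.
  apply: (@near_eq_derivable _ _ _ (cst 0)) => //.
  have nK : nbhs y (~` K) by apply: open_nbhs_nbhs; split => //; exact: closed_openC.
  by apply: filterS nK => z Kz; rewrite G0.
have cdG i : continuous (partial i (G i)).
  rewrite G'E; apply: (continuous_extension0 cK KO); first exact: dG0.
  move=> y Oy; rewrite /dG.
  have cwi : {for y, continuous (fun z => w z * partial i u z)}.
    by apply: continuousM; [exact: w_continuous|exact: Ck2_continuous_partial].
  apply: continuousD; last first.
    by apply: continuousM; [exact: cwi|exact: cdphi].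
  apply: continuousM; last exact: cphi.
  apply: continuousD.
    apply: continuousM; last exact: Ck2_continuous_partial.
    apply: continuousM; last exact: cst_continuous.
    by apply: continuousM; [exact: last_inv_continuous|exact: w_continuous].
  by apply: continuousM; [exact: w_continuous|exact: Ck2_continuous_partial2].
pose P y := w y * weighted_laplacian alpha u y * phi y.
have P0 y : ~ K y -> P y = 0 by move=> Ky; rewrite /P phi0 // mulr0.
have cP : continuous P.
  apply: (continuous_extension0 cK KO) => // y Oy.
  apply: continuousM; last exact: cphi.
  by apply: continuousM; [exact: w_continuous|exact: weighted_laplacian_continuous].
have w_ge0 y : 0 <= w y by exact: powR_ge0.
have P_ge0 y : 0 <= P y.
  have [/KP[_ Ly]|/P0 -> //] := pselect (K y).
  by rewrite /P mulr_ge0 ?bump_ge0 // mulr_ge0 // ltW.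
have Px : 0 < P x.
  rewrite /P !mulr_gt0 //.
    by rewrite powR_gt0 // normr_gt0 last_neq0.
  by apply: bump_gt0 => i; rewrite subrr normr0.
pose f y := w y * dotp (grad u y) (grad phi y).
have fE y : f y = \sum_(i < n.+1) dG i y - P y.
  have [/KO Oy|Ky] := pselect (K y); last first.
    rewrite P0 // subr0 big1 => [|i _]; last exact: dG0.
    by rewrite /f /dotp big1 ?mulr0 // => i _; rewrite !mxE dphi0 // mulr0.
  have S1 (a : R) : \sum_(i < n.+1) a * (ord_max == i)%:R * partial i u y
      = a * partial ord_max u y.
    rewrite (bigD1 ord_max) //= eqxx mulr1 big1 ?addr0 // => i imax.
    by rewrite eq_sym (negbTE imax) mulr0 mul0r.
  have S2 : \sum_(i < n.+1) w y * partial i u y * partial i phi y = f y.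
    by rewrite /f /dotp mulr_sumr; apply: eq_bigr => i _; rewrite !mxE mulrA.
  rewrite /dG big_split /= S2 -mulr_suml big_split /= S1 -mulr_sumr.
  by rewrite /P /weighted_laplacian; ring.
have IdG i : (\int[lebesgue_measure_n R n.+1]_t (dG i (row_of t))%:E = 0)%E.
  rewrite -G'E; exact: (integral_partial0 r0 (derG i) (cdG i) (G0 i)).
have fO : (fun t => (f (row_of t))%:E) =
    (fun t => (f (row_of t))%:E) \_ (@row_of R n.+1 @^-1` unit_ball R n.+1).
  apply/funext => t; rewrite patchE; case: ifPn => // /negP; rewrite inE => nB.
  rewrite fE P0 ?subr0; last by move=> /KO[].
  by rewrite big1 // => i _; rewrite dG0 // => /KO[].
have IdGi i : (lebesgue_measure_n R n.+1).-integrable setT (fun t => (dG i (row_of t))%:E).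
  have pG0 y : ~ cube x r y -> partial i (G i) y = 0 by move=> Ky; rewrite G'E dG0.
  by rewrite -G'E; exact: (continuous_cube_integrable (ltW r0) (cdG i) pG0).
have IP : (lebesgue_measure_n R n.+1).-integrable setT (fun t => (P (row_of t))%:E).
  exact: (continuous_cube_integrable (ltW r0) cP P0).
have := weak phi (bump_test_function KB) (bump_ge0 _ _).
rewrite /integral_Rn -/(@row_of R n.+1).
rewrite (_ : (\int[_]_(t in _) _)%E = - (\int[lebesgue_measure_n R n.+1]_t (P (row_of t))%:E))%E.
  by rewrite leNgt oppe_lt0 (integral_cube_gt0 (ltW r0) cP P0 P_ge0 Px).
rewrite integral_mkcond -fO.
under eq_integral do rewrite fE EFinB -sumEFin.
rewrite integralB //; last exact: integrable_sum.
by rewrite integral_sum // big1 ?sub0e.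
Qed.

End pointwise.

(** * Second order conditions at a minimum *)

(** If [f2 < 0], then [f1 < 0] just to the right of [0], and the mean value theorem
makes [f] decrease there. *)
Lemma second_derivative_test (R : realType) (f f1 : R -> R) (f2 d : R) :
  0 < d ->
  (forall t : R, `|t| < d -> is_derive t 1 f (f1 t)) -> is_derive (0 : R) 1 f1 f2 ->
  (forall t, `|t| < d -> f 0 <= f t) -> f1 0 = 0 /\ 0 <= f2.
Proof.
move=> d0 df df1 fmin.
have f10 : f1 0 = 0.
  have Nd : - d <= d by rewrite ge0_cp // ltW.
  have d0in : (0 : R) \in `](- d), d[ by rewrite in_itv /= oppr_lt0 d0.
  have [_ D0] : is_derive (0 : R) 1 f 0.
    by apply: (derive1_at_min Nd _ d0in) => t; rewrite in_itv /= -ltr_norml;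
      [case/df|exact: fmin].
  by have := df 0; rewrite normr0 => /(_ d0)[_]; rewrite D0.
split=> //; rewrite leNgt; apply/negP => f2lt0.
have [df1' D] := df1.
have : \forall h \near 0^', h^-1 * f1 h < 0.
  have /cvgr_lt := df1'; rewrite -/(derive f1 (0:R) 1) D => /(_ 0 f2lt0).
  apply: filterS => h; rewrite /= f10 subr0 addr0 /GRing.scale /= mulr1; exact.
move=> /nbhs_ballP[e /= e0 eP].
pose h := Num.min d e / 2.
have h0 : 0 < h by rewrite divr_gt0 // lt_min d0.
have [hd he] : h < d /\ h < e.
  have : h < Num.min d e by rewrite ltr_pdivrMr // mulr_natr mulr2n ltrDl lt_min d0.
  by rewrite lt_min => /andP[].
have [c|c|c cin cE] := @MVT R f f1 0 h h0.
- rewrite in_itv /= => /andP[c0 ch]; apply: df.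
  by rewrite gtr0_norm // (lt_trans ch).
- apply: continuous_in_subspaceT => t; rewrite inE /= in_itv /= => /andP[t0 th].
  by apply: is_derive_continuous (df t _); rewrite ger0_norm // (le_lt_trans th).
move: cin; rewrite in_itv /= => /andP[c0 ch].
have : f1 c < 0.
  have := eP c;
    rewrite -ball_normE /ball_ /= sub0r normrN gtr0_norm // => /(_ (lt_trans ch he)).
  move=> /(_ (lt0r_neq0 c0)); rewrite pmulr_rlt0 // invr_gt0 //.
have : f 0 <= f h by apply: fmin; rewrite gtr0_norm.
rewrite -subr_ge0 cE subr0 pmulr_lge0 // leNgt => /negbTE ->; by [].
Qed.

Lemma second_partial_test (R : realType) (n : nat) (i : 'I_n)
    (z z1 : 'rV[R]_n -> R) (z2 : R) (x : 'rV[R]_n) :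
  (\forall y \near x, is_derive y (evec R i) z (z1 y)) ->
  is_derive x (evec R i) z1 z2 -> (\forall y \near x, z x <= z y) ->
  z1 x = 0 /\ 0 <= z2.
Proof.
move=> dz dz1 zmin.
pose l (t : R) : 'rV[R]_n := t *: evec R i + x.
have l0 : l 0 = x by rewrite /l scale0r add0r.
have cl : {for 0, continuous l}.
  apply: continuous_rowP => j.
  rewrite (_ : (fun t => _) = fun t => t * (evec R i ord0 j) + x ord0 j); last first.
    by apply/funext => t; rewrite /l !mxE.
  apply: continuousD; last exact: cst_continuous.
  by apply: continuousM; last exact: cst_continuous.
have : \forall t \near (0 : R), is_derive (l t) (evec R i) z (z1 (l t)) /\ z x <= z (l t).
  by apply: (cl (fun y => is_derive y (evec R i) z (z1 y) /\ z x <= z y));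
    rewrite l0; exact: filterI.
move=> /nbhs_ballP[d /= d0 dP].
have dP' t : `|t| < d -> is_derive (l t) (evec R i) z (z1 (l t)) /\ z x <= z (l t).
  by move=> td; apply: dP; rewrite -ball_normE /ball_ /= sub0r normrN.
have := @second_derivative_test R (z \o l) (z1 \o l) z2 d d0.
rewrite /= l0; apply.
- by move=> t /dP'[dzt _]; apply/is_derive_lineP.
- exact/is_derive_line0.
- by move=> t /dP'[].
Qed.

(** * The comparison function *)

Definition sqdist (R : realType) (n : nat) (p x : 'rV[R]_n) : R :=
  dotp (x - p) (x - p).

Lemma sqdistE (R : realType) (n : nat) (p x : 'rV[R]_n) :
  sqdist p x = \sum_(i < n) (x ord0 i - p ord0 i) ^+ 2.
Proof. by apply: eq_bigr => i _; rewrite !mxE expr2. Qed.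

Lemma sqdist_continuous (R : realType) (n : nat) (p : 'rV[R]_n) :
  continuous (sqdist p).
Proof.
move=> x; rewrite (_ : sqdist p = fun x : 'rV[R]_n => \sum_(i < n) (x ord0 i - p ord0 i) ^+ 2).
  apply: continuous_sum_at => i.
  apply: (@continuous_comp _ _ _ (fun y : 'rV[R]_n => y ord0 i - p ord0 i) (fun t => t ^+ 2)).
    by apply: continuousB; [exact: coord_continuous|exact: cst_continuous].
  exact: exprn_continuous.
by apply/funext => y; rewrite sqdistE.
Qed.

Lemma is_derive_sqdist (R : realType) (n : nat) (p x : 'rV[R]_n) (i : 'I_n) :
  is_derive x (evec R i) (sqdist p) (2 * (x ord0 i - p ord0 i)).
Proof.
apply/is_derive_line0.
have lE (t : R) : sqdist p (t *: evec R i + x) = t * t + (t * (2 * (x ord0 i - p ord0 i)) + sqdist p x).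
  rewrite !sqdistE (bigD1 i) //= [in RHS](bigD1 i) //= !mxE !eqxx /=.
  rewrite (eq_bigr (fun j => (x ord0 j - p ord0 j) ^+ 2)) => [|j ji].
    by ring.
  by rewrite !mxE (negbTE ji) mulr0 add0r.
rewrite (_ : (fun t => _) = fun t => t * t + (t * (2 * (x ord0 i - p ord0 i)) + sqdist p x)).
  have did := is_derive_id (0 : R) (1 : R).
  have d1 := is_derive_mul did did.
  have d2 := is_derive_mul did (is_derive_cst (2 * (x ord0 i - p ord0 i)) (0 : R) (1 : R)).
  have d3 := is_derive_add d2 (is_derive_cst (sqdist p x) (0 : R) (1 : R)).
  have := is_derive_add d1 d3.
  by rewrite /= mulr0 mul0r mulr0 !addr0 mul1r add0r.
by apply/funext => t; rewrite lE.
Qed.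

Section barrier.
Variables (R : realType) (n : nat) (alpha : R) (u : 'rV[R]_n.+1 -> R).
Let O : set 'rV[R]_n.+1 := unit_ball R n.+1 `\` [set x | last_coord x = 0].
Hypothesis C2u : Ck_on 2 O u.
Hypothesis alpha_gt : 1 / 2 < alpha.
Hypothesis Lu : forall x, O x -> weighted_laplacian alpha u x <= 0.

(** The comparison difference, up to an additive constant. *)
Definition barrier (p : 'rV[R]_n.+1) (k eps eta : R) (x : 'rV[R]_n.+1) : R :=
  u x - eps * expR (- k * sqdist p x) - eta * ln `|last_coord x|.

(** At an interior minimum the operator applied to the barrier would be
nonnegative.  It is negative: [u] contributes a nonpositive amount, the
logarithm [eta (1 - 2 alpha) / x_N^2], and the exponential
[- 2 k eps E (2 k |x - p|^2 - N - 2 alpha + 2 alpha p_N / x_N)] with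
[E = exp (- k |x - p|^2)], which is nonpositive by the assumption on [k] since
[p_N] and [x_N] have the same sign. *)
Lemma barrier_no_interior_min (p x : 'rV[R]_n.+1) (k eps eta : R) :
  0 <= k -> 0 <= eps -> 0 < eta -> O x -> 0 < last_coord p * last_coord x ->
  n.+1%:R + 2 * alpha <= 2 * k * sqdist p x ->
  ~ (\forall y \near x, barrier p k eps eta x <= barrier p k eps eta y).
Proof.
move=> k0 eps0 eta0 Ox px kd zmin.
pose E y := expR (- k * sqdist p y).
pose D (i : 'I_n.+1) : R := (ord_max == i)%:R.
have oO : open O by exact: open_split_ball.
have dE i y : is_derive y (evec R i) E (E y * (- k * (2 * (y ord0 i - p ord0 i)))).
  have d1 := is_derive_mul (is_derive_cst (- k) y (evec R i)) (is_derive_sqdist p y i).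
  have := is_derive_comp (is_derive_expR _) d1.
  by rewrite mul0r add0r.
pose z1 i y := partial i u y + (- eps) * (E y * (- k * (2 * (y ord0 i - p ord0 i))))
   + (- eta) * ((last_coord y)^-1 * D i).
have dz i y : O y -> is_derive y (evec R i) (barrier p k eps eta) (z1 i y).
  move=> Oy; have y0 : last_coord y != 0 by case: Oy => _ /eqP.
  have d1 := Ck2_partial C2u i Oy.
  have d2 := is_derive_mul (is_derive_cst (- eps) y (evec R i)) (dE i y).
  have d3 := is_derive_mul (is_derive_cst (- eta) y (evec R i))
    (is_derive_comp (is_derive_ln_norm y0) (is_derive_coord ord_max i y)).
  have := is_derive_add (is_derive_add d1 d2) d3.
  rewrite !mul0r !add0r /cst => dz; have -> : barrier p k eps eta =
      fun y => u y + - eps * E y + - eta * ln `|y ord0 ord_max|; last exact: dz.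
  by apply/funext => v; rewrite /barrier (mulNr eps) (mulNr eta).
pose z2 i := partial i (partial i u) x
  + (- eps) * (E x * (- k * (2 * (x ord0 i - p ord0 i))) * (- k * (2 * (x ord0 i - p ord0 i)))
      + E x * (- k * 2))
  + (- eta) * (- (last_coord x) ^- 2 * D i).
have x0 : last_coord x != 0 by case: Ox => _ /eqP.
have D2 i : D i * D i = D i by rewrite /D; case: eqP; rewrite ?mulr1 ?mulr0.
have dz1 i : is_derive x (evec R i) (z1 i) (z2 i).
  have d1 := Ck2_partial2 C2u i i Ox.
  have dc a := is_derive_cst (a : R) x (evec R i).
  have dx := is_derive_add (is_derive_coord i i x) (dc (- p ord0 i)).
  have d2 := is_derive_mul (dc (- eps)) (is_derive_mul (dE i x)
     (is_derive_mul (dc (- k)) (is_derive_mul (dc 2) dx))).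
  have d3 := is_derive_mul (dc (- eta)) (is_derive_mul
    (is_derive_comp (is_derive_inv x0) (is_derive_coord ord_max i x)) (dc (D i))).
  have := is_derive_add (is_derive_add d1 d2) d3.
  rewrite /cst !mul0r !add0r eqxx !addr0 !mulr0 !addr0 mulr1 -/(D i).
  by rewrite -(mulrA _ (D i)) D2.
have nO : \forall y \near x, O y by exact: open_nbhs_nbhs.
have z12 i : z1 i x = 0 /\ 0 <= z2 i.
  apply: second_partial_test (dz1 i) zmin.
  by apply: filterS nO => y; exact: dz.
have S : 0 <= \sum_(i < n.+1) z2 i + 2 * alpha / last_coord x * z1 ord_max x.
  by rewrite (z12 _).1 mulr0 addr0; apply: sumr_ge0 => i _; rewrite (z12 i).2.
have SD : \sum_(i < n.+1) D i = 1.
  rewrite (bigD1 ord_max) //= /D eqxx big1 ?addr0 // => i imax.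
  by rewrite eq_sym (negbTE imax).
have Sz2 : \sum_(i < n.+1) z2 i = \sum_(i < n.+1) partial i (partial i u) x
   - eps * E x * (4 * k ^+ 2 * sqdist p x - 2 * k * n.+1%:R) + eta * (last_coord x) ^- 2.
  rewrite /z2 !big_split /= -!mulr_sumr SD mulr1 mulrNN big_split /=.
  rewrite sumr_const card_ord.
  have -> : \sum_(i < n.+1) E x * (- k * (2 * (x ord0 i - p ord0 i)))
      * (- k * (2 * (x ord0 i - p ord0 i))) = E x * (4 * k ^+ 2) * sqdist p x.
    by rewrite sqdistE mulr_sumr; apply: eq_bigr => i _; ring.
  by rewrite -[_ *+ n.+1]mulr_natr; ring.
have pE : 0 < last_coord p / last_coord x.
  by rewrite -(pmulr_lgt0 _ (_ : 0 < last_coord x ^+ 2)) ?exprn_even_gt0 // expr2 mulrA divfK.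
have := Lu Ox; move: S; rewrite Sz2 /weighted_laplacian.
have z1E : 2 * alpha / last_coord x * z1 ord_max x = 2 * alpha / last_coord x * partial ord_max u x
   + eps * E x * (2 * alpha * (2 * k) * (1 - last_coord p / last_coord x))
   - eta * (2 * alpha) * (last_coord x) ^- 2.
  rewrite /z1 /D eqxx -/(last_coord x) -/(last_coord p) /=; field; exact: x0.
rewrite z1E => S1 S2.
have xx : 0 < last_coord x ^- 2 by rewrite invr_gt0 exprn_even_gt0.
have a1 : 0 < 2 * alpha - 1 by move: alpha_gt; lra.
have e1 : 0 < eta * (last_coord x ^- 2 * (2 * alpha - 1)).
  by rewrite mulr_gt0 // mulr_gt0.
have e2 : 0 <= eps * E x * (2 * k * (2 * k * sqdist p x - n.+1%:R - 2 * alpha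
    + 2 * alpha * (last_coord p / last_coord x))).
  rewrite mulr_ge0 ?mulr_ge0 ?expR_ge0 //.
  have : 0 <= 2 * alpha * (last_coord p / last_coord x).
    by apply: mulr_ge0; [lra|exact: ltW].
  lra.
lra.
Qed.

End barrier.

(** * The Euclidean norm *)

Lemma coord_le_enorm (R : realType) (n : nat) (x : 'rV[R]_n) (i : 'I_n) :
  `|x ord0 i| <= enorm x.
Proof.
rewrite /enorm -sqrtr_sqr ler_sqrt; last by apply: sumr_ge0 => j _;
  rewrite -expr2 sqr_ge0.
rewrite /dotp (bigD1 i) //= expr2 lerDl.
by apply: sumr_ge0 => j _; rewrite -expr2 sqr_ge0.
Qed.

Lemma enorm_cube (R : realType) (n : nat) (x : 'rV[R]_n) (r : R) :
  enorm x <= r -> cube 0 r x.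
Proof. by move=> xr i; rewrite mxE subr0 (le_trans (coord_le_enorm x i)). Qed.

Lemma dotp_ge0 (R : realType) (n : nat) (x : 'rV[R]_n) : 0 <= dotp x x.
Proof. by apply: sumr_ge0 => i _; rewrite -expr2 sqr_ge0. Qed.

Lemma enorm_ge0 (R : realType) (n : nat) (x : 'rV[R]_n) : 0 <= enorm x.
Proof. exact: sqrtr_ge0. Qed.

Lemma sqr_enorm (R : realType) (n : nat) (x : 'rV[R]_n) : enorm x ^+ 2 = dotp x x.
Proof. by rewrite sqr_sqrtr // dotp_ge0. Qed.

Lemma dotp_comb (R : realType) (n : nat) (x y : 'rV[R]_n) (a b : R) :
  dotp (a *: x + b *: y) (a *: x + b *: y)
  = a ^+ 2 * dotp x x + 2 * (a * b) * dotp x y + b ^+ 2 * dotp y y.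
Proof.
rewrite /dotp !mulr_sumr -!big_split /=; apply: eq_bigr => i _; rewrite !mxE; ring.
Qed.

(** Cauchy-Schwarz, from the nonnegativity of the square of
[|y|^2 x - (x . y) y]. *)
Lemma dotp_le_enorm (R : realType) (n : nat) (x y : 'rV[R]_n) :
  dotp x y <= enorm x * enorm y.
Proof.
have [|] := leP (dotp x y) 0.
  by move=> /le_trans; apply; rewrite mulr_ge0 ?enorm_ge0.
move=> xy0; set a := enorm x; set b := enorm y.
have a0 : 0 <= a := enorm_ge0 x; have b0 : 0 <= b := enorm_ge0 y.
rewrite -ler_sqr ?nnegrE ?(ltW xy0) ?mulr_ge0 // exprMn.
have := dotp_ge0 (dotp y y *: x + (- dotp x y) *: y).
rewrite dotp_comb -!sqr_enorm -/a -/b.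
rewrite le_eqVlt in b0; case/orP: b0 => [/eqP b0|b0].
  have y0 i : y ord0 i = 0.
    apply/eqP; rewrite -normr_le0; have := coord_le_enorm y i; by rewrite -/b -b0.
  by move: xy0; rewrite /dotp big1 ?ltxx // => i _; rewrite y0 mulr0.
move=> h; have : 0 <= b ^+ 2 * (a ^+ 2 * b ^+ 2 - dotp x y ^+ 2).
  by apply: le_trans h _; rewrite le_eqVlt; apply/orP; left; apply/eqP; ring.
by rewrite pmulr_rge0 ?exprn_gt0 // subr_ge0.
Qed.

Lemma ler_enormD (R : realType) (n : nat) (x y : 'rV[R]_n) :
  enorm (x + y) <= enorm x + enorm y.
Proof.
rewrite -ler_sqr ?nnegrE ?addr_ge0 ?enorm_ge0 // sqr_enorm.
have := dotp_comb x y 1 1; rewrite !scale1r => ->.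
by rewrite sqrrD -!sqr_enorm; have := dotp_le_enorm x y; lra.
Qed.

Lemma enormZ (R : realType) (n : nat) (a : R) (x : 'rV[R]_n) :
  enorm (a *: x) = `|a| * enorm x.
Proof.
have := dotp_comb x x a 0; rewrite scale0r addr0 /enorm => ->.
by rewrite mulr0 !(mul0r, mulr0, expr0n) !addr0 sqrtrM ?sqr_ge0 // sqrtr_sqr.
Qed.

Lemma enorm_evec (R : realType) (n : nat) (i : 'I_n) : enorm (evec R i) = 1.
Proof.
rewrite /enorm /dotp (bigD1 i) //= big1 ?addr0 => [|j ji].
  by rewrite mxE !eqxx mulr1 sqrtr1.
by rewrite mxE (negbTE ji) mulr0.
Qed.

(** * A lower bound of Hopf type *)

Section propagation.
Variables (R : realType) (n : nat) (alpha : R) (u : 'rV[R]_n.+1 -> R) (m : R).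
Let O : set 'rV[R]_n.+1 := unit_ball R n.+1 `\` [set x | last_coord x = 0].
Hypothesis C2u : Ck_on 2 O u.
Hypothesis alpha_gt : 1 / 2 < alpha.
Hypothesis Lu : forall x, O x -> weighted_laplacian alpha u x <= 0.
Hypothesis cu : forall x, unit_ball R n.+1 x -> {for x, continuous u}.
Hypothesis u_ge : forall x, unit_ball R n.+1 x -> m <= u x.

(** Suppose that the bound fails at [y].  For [eta] small the barrier at [y] is
still below [c0 = m - eps exp (- k rho)], whereas it is at least [c0] wherever
[u] is known to be large, on the sphere [sqdist p x = rho], and close to the
hyperplane, where the logarithm takes over.  The barrier therefore has a minimum
in the interior of the compact set that these three regions bound, which
[barrier_no_interior_min] forbids. *)
Lemma hopf_lower_bound (p : 'rV[R]_n.+1) (rho : R) :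
  last_coord p != 0 -> m < u p ->
  (forall x, sqdist p x <= rho -> unit_ball R n.+1 x) -> 0 <= rho ->
  exists k eps, [/\ 0 < k, 0 < eps &
    forall x, sqdist p x <= rho -> 0 < last_coord p * last_coord x ->
      m + eps * (expR (- k * sqdist p x) - expR (- k * rho)) <= u x].
Proof.
move=> p0 mp ballP rho0.
have Bp : unit_ball R n.+1 p.
  by apply: ballP; rewrite sqdistE big1 // => i _; rewrite subrr expr0n.
pose eps := (u p - m) / 2.
have eps0 : 0 < eps by rewrite divr_gt0 // subr_gt0.
have [s s0 sP] : exists2 s, 0 < s & forall x, sqdist p x <= s -> m + eps <= u x.
  have : \forall x \near p, m + eps < u x.
    by have /cvgr_gt := cu Bp; apply; rewrite /eps; lra.
  move=> /nbhs_ballP[e /= e0 eP]; exists ((e / 2) ^+ 2).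
    by rewrite exprn_gt0 // divr_gt0.
  move=> x xs; apply/ltW/eP; split => // i j; rewrite (ord1 i) -ball_normE /ball_ /=.
  rewrite distrC (@le_lt_trans _ _ (e / 2)) //;
    last by rewrite ltr_pdivrMr // mulr_natr mulr2n ltrDl.
  rewrite -ler_sqr ?nnegrE ?divr_ge0 ?(ltW e0) // real_normK ?num_real //.
  rewrite (le_trans _ xs) // sqdistE (bigD1 j) //= lerDl.
  by apply: sumr_ge0 => l _; rewrite sqr_ge0.
(* With this [k] the condition on [k] in [barrier_no_interior_min] holds where
   [s <= sqdist p x]. *)
pose k := (n.+1%:R + 2 * alpha) / (2 * s).
have na : 0 < n.+1%:R + 2 * alpha :> R by rewrite addr_gt0 ?ltr0n //; move: alpha_gt;
  lra.
have k0 : 0 < k by rewrite divr_gt0 // mulr_gt0.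
exists k, eps; split => // y yrho py.
rewrite leNgt; apply/negP => uy.
have last_le1 x : unit_ball R n.+1 x -> `|last_coord x| <= 1.
  by move=> /ltW; apply: le_trans; exact: coord_le_enorm.
have ln_le0 x : unit_ball R n.+1 x -> ln `|last_coord x| <= 0.
  by move=> /last_le1; exact: ln_le0.
have y0 : last_coord y != 0 by apply: contraTneq py => ->; rewrite mulr0 ltxx.
set c0 := m - eps * expR (- k * rho).
have c0m : c0 < m by rewrite /c0 gtrBl mulr_gt0 ?expR_gt0.
(* The bound fails by [d] at [y]; [eta] is such that the logarithm costs less
   than [d] there. *)
pose d := c0 - (u y - eps * expR (- k * sqdist p y)).
have d0 : 0 < d by rewrite /d /c0; move: uy; rewrite mulrBr; lra.
pose eta := d / (2 * (1 - ln `|last_coord y|)).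
have By := ballP _ yrho; have lny := ln_le0 y By.
have eta0 : 0 < eta by rewrite divr_gt0 // mulr_gt0 //; lra.
pose z := barrier u p k eps eta.
have zy : z y < c0.
  have : - (eta * ln `|last_coord y|) < d.
    rewrite /eta -mulrN mulrAC ltr_pdivrMr; last by rewrite mulr_gt0 //; lra.
    by rewrite ltr_pM2l //; lra.
  by rewrite /z /barrier /d; lra.
have expR_le1 x : eps * expR (- k * sqdist p x) <= eps.
  rewrite ler_piMr ?(ltW eps0) // -expR0 ler_expR mulNr oppr_le0 mulr_ge0 ?(ltW k0) //.
  by rewrite sqdistE; apply: sumr_ge0 => i _; rewrite sqr_ge0.
(* Where [|x_N| <= del], the term [- eta ln |x_N|] is at least [eps]. *)
pose del := expR (- (eps / eta)).
have del0 : 0 < del by exact: expR_gt0.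
have z_far x : unit_ball R n.+1 x -> last_coord x != 0 -> `|last_coord x| <= del -> m <= z x.
  move=> Bx x0 xd.
  have : ln `|last_coord x| <= - (eps / eta).
    by rewrite -[leRHS]expRK ler_ln ?posrE ?normr_gt0 ?expR_gt0.
  rewrite -(ler_pM2l eta0) mulrN mulrCA divff ?lt0r_neq0 // mulr1 => h.
  by rewrite /z /barrier; have := u_ge Bx; have := expR_le1 x; lra.
have z_near x : unit_ball R n.+1 x -> sqdist p x <= s -> m <= z x.
  move=> Bx /sP ux; rewrite /z /barrier; have := expR_le1 x.
  have : eta * ln `|last_coord x| <= 0 by rewrite pmulr_rle0 // ln_le0.
  lra.
have z_rho x : unit_ball R n.+1 x -> sqdist p x = rho -> c0 <= z x.
  move=> Bx xrho; rewrite /z /barrier /c0 xrho; have := u_ge Bx.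
  have : eta * ln `|last_coord x| <= 0 by rewrite pmulr_rle0 // ln_le0.
  lra.
pose K : set 'rV[R]_n.+1 := sqdist p @^-1` `[s, rho]%classic `&`
  (fun x => last_coord p * last_coord x) @^-1` [set t | `|last_coord p| * del <= t].
have pn0 : 0 < `|last_coord p| by rewrite normr_gt0.
have KP x : K x -> unit_ball R n.+1 x /\ last_coord x != 0.
  move=> [/=]; rewrite in_itv /= => /andP[_ /ballP Bx] h; split => //.
  by apply: contraTneq h => ->; rewrite mulr0 -ltNge mulr_gt0.
have normE x : 0 < last_coord p * last_coord x ->
    last_coord p * last_coord x = `|last_coord p| * `|last_coord x|.
  by move=> h; rewrite -normrM gtr0_norm.
have Ky : K y.
  split => /=; first rewrite in_itv /= yrho andbT.
    rewrite leNgt; apply/negP => /ltW /(z_near _ By); lra.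
  rewrite normE // ler_pM2l // leNgt; apply/negP => /ltW /(z_far _ By y0); lra.
have clast : continuous (fun x : 'rV[R]_n.+1 => last_coord p * last_coord x).
  by move=> x; apply: (@continuousM _ _ (cst (last_coord p)));
    [exact: cst_continuous|exact: last_coord_continuous].
have cK : compact K.
  have clK : closed K.
    apply: closedI; apply: closed_comp.
    - by move=> x _; exact: sqdist_continuous.
    - exact: itv_closed.
    - by move=> x _; exact: clast.
    - exact: closed_ge.
  apply: subclosed_compact clK (@cube_compact R n.+1 0 1) _.
  by move=> x /KP[/ltW Bx _]; exact: enorm_cube.
have cz : {within K, continuous z}.
  apply: continuous_in_subspaceT => x /set_mem /KP[Bx x0].
  have cE : {for x, continuous (fun x => eps * expR (- k * sqdist p x))}.
    apply: continuousM; first exact: cst_continuous.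
    apply: (@continuous_comp _ _ _ (fun x => - k * sqdist p x) expR);
      last exact: continuous_expR.
    by apply: continuousM; [exact: cst_continuous|exact: sqdist_continuous].
  have cln : {for x, continuous (fun x => eta * ln `|last_coord x|)}.
    apply: continuousM; first exact: cst_continuous.
    apply: (@continuous_comp _ _ _ (@last_coord R n) (fun t => ln `|t|));
      first exact: last_coord_continuous.
    exact: is_derive_continuous (is_derive_ln_norm x0).
  exact: continuousB (continuousB (cu Bx) cE) cln.
have [x /set_mem Kx xmin] : exists2 x, x \in K & forall t, t \in K -> z x <= z t.
  by apply: EVT_min_rV => //; exists y.
have [Bx x0] := KP x Kx.
have zx : z x < c0 by apply: le_lt_trans zy; apply: xmin; exact: mem_set.
have [/=] := Kx; rewrite in_itv /= => /andP[sx xrho] xdel.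
have px : 0 < last_coord p * last_coord x by rewrite (lt_le_trans _ xdel) // mulr_gt0.
have sx' : s < sqdist p x.
  rewrite ltNge; apply/negP => /(z_near x Bx); lra.
have xrho' : sqdist p x < rho.
  rewrite lt_neqAle xrho andbT; apply/eqP => /(z_rho x Bx); lra.
have xdel' : `|last_coord p| * del < last_coord p * last_coord x.
  rewrite normE // ltr_pM2l // ltNge; apply/negP => /(z_far x Bx x0); lra.
apply: (barrier_no_interior_min C2u alpha_gt Lu (ltW k0) (ltW eps0) eta0 _ px).
- by split => //; exact/eqP.
- have -> : n.+1%:R + 2 * alpha = 2 * k * s by rewrite /k; field; exact: lt0r_neq0.
  by rewrite ler_pM2l // mulr_gt0.
have cq := @sqdist_continuous R n.+1 p x.
near=> t; apply: xmin; apply/mem_set; split => /=.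
  rewrite in_itv /=; apply/andP; split; apply: ltW.
    near: t; by have /cvgr_gt := cq; exact.
  near: t; by have /cvgr_lt := cq; exact.
apply: ltW; near: t; by have /cvgr_gt := clast x; exact.
Unshelve. all: by end_near. Qed.

End propagation.

(** * Propagation of the minimum *)

Lemma last_coordD (R : realType) (n : nat) (x y : 'rV[R]_n.+1) (a : R) :
  last_coord (a *: y + x) = a * last_coord y + last_coord x.
Proof. by rewrite /last_coord !mxE. Qed.

Lemma last_coord_evec (R : realType) (n : nat) :
  last_coord (evec R (ord_max : 'I_n.+1)) = 1.
Proof. by rewrite /last_coord mxE !eqxx. Qed.

Lemma cvg_line (R : realType) (n : nat) (u : 'rV[R]_n -> R) (x v : 'rV[R]_n) :
  {for x, continuous u} -> u (t *: v + x) @[t --> (0:R)] --> u x.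
Proof.
move=> cu; rewrite -[in X in _ --> X](add0r x) -(scale0r v).
apply: (@continuous_comp _ _ _ (fun t : R => t *: v + x) u); last first.
  by rewrite scale0r add0r.
apply: continuous_rowP => i.
rewrite (_ : (fun t => _) = fun t : R => t * v ord0 i + x ord0 i).
  apply: continuousD; last exact: cst_continuous.
  by apply: continuousM; last exact: cst_continuous.
by apply/funext => t; rewrite !mxE.
Qed.

(** How a bound off the hyperplane reaches the hyperplane: along a segment that
leaves it. *)
Lemma line_limit_ge (R : realType) (n : nat) (u : 'rV[R]_n -> R) (x v : 'rV[R]_n) (a d : R) :
  0 < d -> {for x, continuous u} ->
  (forall t, 0 < t < d -> a <= u (t *: v + x)) -> a <= u x.
Proof.
move=> d0 cu h; rewrite leNgt; apply/negP => ua.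
have /cvgr_lt := cvg_line v cu; move=> /(_ _ ua) /nbhs_ballP[e /= e0 eP].
pose t := Num.min d e / 2.
have m0 : 0 < Num.min d e by rewrite lt_min d0.
have t0 : 0 < t by rewrite divr_gt0.
have : t < Num.min d e by rewrite ltr_pdivrMr // mulr_natr mulr2n ltrDl.
rewrite lt_min => /andP[td te].
have := h t; rewrite t0 td => /(_ isT); apply/negP; rewrite -ltNge.
by apply: eP; rewrite -ball_normE /ball_ /= sub0r normrN gtr0_norm.
Qed.

Section strong_minimum.
Variables (R : realType) (n : nat) (alpha : R) (u : 'rV[R]_n.+1 -> R) (m : R).
Let O : set 'rV[R]_n.+1 := unit_ball R n.+1 `\` [set x | last_coord x = 0].
Hypothesis C2u : Ck_on 2 O u.
Hypothesis alpha_gt : 1 / 2 < alpha.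
Hypothesis Lu : forall x, O x -> weighted_laplacian alpha u x <= 0.
Hypothesis cu : forall x, unit_ball R n.+1 x -> {for x, continuous u}.
Hypothesis u_ge : forall x, unit_ball R n.+1 x -> m <= u x.

(** Otherwise [u p > m], and [hopf_lower_bound] applies on a ball around [p] that
contains [x0] in its interior and is contained in the unit ball.  Points of the
segment from [x0] to [p], other than [x0], are strictly on the side of [p] even
when [x0] lies on the hyperplane, so that the bound is inherited by [x0] in the limit. *)
Lemma min_propagates (x0 p : 'rV[R]_n.+1) :
  unit_ball R n.+1 x0 -> u x0 = m -> last_coord p != 0 ->
  0 <= last_coord p * last_coord x0 -> enorm (x0 - p) < 1 - enorm p -> u p = m.
Proof.
move=> Bx0 ux0 p0 px0 x0p.
have Bp : unit_ball R n.+1 p.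
  by rewrite /unit_ball /= -subr_gt0 (le_lt_trans _ x0p) ?enorm_ge0.
apply/eqP; rewrite eq_le u_ge // andbT leNgt; apply/negP => mp.
pose r := (enorm (x0 - p) + (1 - enorm p)) / 2.
have [r1 r2] : enorm (x0 - p) < r /\ r < 1 - enorm p by rewrite /r; split; lra.
have r0 : 0 <= r by rewrite (le_trans (enorm_ge0 _) (ltW r1)).
have [||k [eps [k0 eps0 H]]] := hopf_lower_bound C2u alpha_gt Lu cu u_ge p0 mp (rho := r ^+ 2).
- move=> x; rewrite /sqdist -sqr_enorm ler_sqr ?nnegrE ?enorm_ge0 // => xr.
  have := ler_enormD (x - p) p; rewrite subrK /unit_ball /=; lra.
- exact: sqr_ge0.
have qx0 : sqdist p x0 < r ^+ 2.
  by rewrite /sqdist -sqr_enorm ltr_sqr ?nnegrE ?enorm_ge0.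
pose a := eps * (expR (- k * sqdist p x0) - expR (- k * r ^+ 2)).
have a0 : 0 < a by rewrite mulr_gt0 // subr_gt0 ltr_expR !mulNr ltrN2 ltr_pM2l.
suff : m + a <= u x0 by rewrite ux0; lra.
apply: (@line_limit_ge _ _ u x0 (p - x0) _ 1) => // [|t /andP[t0 t1]]; first exact: cu.
set y := t *: (p - x0) + x0.
have qy : sqdist p y <= sqdist p x0.
  rewrite /sqdist (_ : y - p = (1 - t) *: (x0 - p)).
    rewrite -!sqr_enorm enormZ ler_sqr ?nnegrE ?mulr_ge0 ?enorm_ge0 //.
    by rewrite ler_piMl ?enorm_ge0 // ger0_norm; lra.
  by apply/rowP => i; rewrite !mxE; ring.
apply: le_trans (H y _ _).
- rewrite lerD2l ler_pM2l // lerD2r ler_expR !mulNr lerN2 ler_pM2l //.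
- by rewrite (le_trans qy) // ltW.
- rewrite /y /last_coord !mxE -/(last_coord p) -/(last_coord x0).
  have pp : 0 < last_coord p ^+ 2 by rewrite exprn_even_gt0.
  have -> : last_coord p * (t * (last_coord p - last_coord x0) + last_coord x0) =
    t * last_coord p ^+ 2 + (1 - t) * (last_coord p * last_coord x0) by ring.
  by apply: ltr_pwDl; [exact: mulr_gt0|apply: mulr_ge0 => //; lra].
Qed.

(** The points [t s e_N] with small [t > 0], on the side of [x0], are reached from
[x0] in one step by the triangle inequality. *)
Lemma min_at_origin (x0 : 'rV[R]_n.+1) :
  unit_ball R n.+1 x0 -> u x0 = m -> u 0 = m.
Proof.
move=> Bx0 ux0.
have e0 : enorm (0 : 'rV[R]_n.+1) = 0 by rewrite -(scale0r 0) enormZ normr0 mul0r.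
have B0 : unit_ball R n.+1 0 by rewrite /unit_ball /= e0.
pose s : R := if 0 <= last_coord x0 then 1 else -1.
have s1 : `|s| = 1 by rewrite /s; case: ifP; rewrite ?normrN normr1.
have sx : 0 <= s * last_coord x0.
  by rewrite /s; case: ifPn; rewrite ?mul1r // -ltNge => /ltW; rewrite mulN1r oppr_ge0.
apply/eqP; rewrite eq_le u_ge // andbT -lerN2.
apply: (@line_limit_ge _ _ (fun x => - u x) 0 (s *: evec R ord_max) _ ((1 - enorm x0) / 2)).
- by rewrite divr_gt0 // subr_gt0.
- by apply: continuousN; exact: cu.
move=> t /andP[t0 t1]; rewrite lerN2 le_eqVlt; apply/orP; left; apply/eqP.
rewrite addr0 scalerA.
have ts : enorm ((t * s) *: evec R (ord_max : 'I_n.+1)) = t.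
  by rewrite enormZ enorm_evec mulr1 normrM s1 mulr1 gtr0_norm.
have lts : last_coord ((t * s) *: evec R (ord_max : 'I_n.+1)) = t * s.
  by have := last_coordD 0 (evec R (ord_max : 'I_n.+1)) (t * s);
     rewrite addr0 last_coord_evec mulr1 => ->; rewrite /last_coord mxE addr0.
apply: min_propagates ux0 _ _ _ => //.
- by rewrite lts -normr_eq0 normrM s1 mulr1 normr_eq0 gt_eqF.
- by rewrite lts -mulrA mulr_ge0 // ltW.
- rewrite ts; have := ler_enormD x0 (- ((t * s) *: evec R (ord_max : 'I_n.+1))).
  rewrite -[in X in _ <= _ + X]scaleN1r enormZ normrN1 mul1r ts; lra.
Qed.

(** From the origin, [p] is reached along the points [(j / M) p] with [M] large: steps of
length [|p| / M < 1 - |p|] are admissible for [min_propagates]. *)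
Lemma strong_minimum_principle (x0 : 'rV[R]_n.+1) :
  unit_ball R n.+1 x0 -> u x0 = m -> forall p, unit_ball R n.+1 p -> u p = m.
Proof.
move=> Bx0 ux0.
have u0 := min_at_origin Bx0 ux0.
have off p : unit_ball R n.+1 p -> last_coord p != 0 -> u p = m.
  move=> Bp p0; have Np := enorm_ge0 p.
  have dp : 0 < 1 - enorm p by rewrite subr_gt0.
  have [M M1] : exists M : nat, enorm p / (1 - enorm p) < M.+1%:R.
    exists (Num.truncn (enorm p / (1 - enorm p))); exact: truncnS_gt.
  have M0 : 0 < M.+1%:R :> R by rewrite ltr0n.
  have chain j : (j <= M.+1)%N -> u ((j%:R / M.+1%:R) *: p) = m.
    elim: j => [_|j IH jM]; first by rewrite mul0r scale0r.
    have s01 : 0 < j.+1%:R / M.+1%:R :> R by rewrite divr_gt0 // ltr0n.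
    have s11 : j.+1%:R / M.+1%:R <= 1 :> R by rewrite ler_pdivrMr // mul1r ler_nat.
    have lZ (a : R) : last_coord (a *: p) = a * last_coord p by rewrite /last_coord mxE.
    have nZ (a : R) : 0 <= a -> enorm (a *: p) = a * enorm p by move=> a0;
      rewrite enormZ ger0_norm.
    have j0 : 0 <= j%:R / M.+1%:R :> R by rewrite divr_ge0.
    have jj : j%:R / M.+1%:R <= j.+1%:R / M.+1%:R :> R by rewrite ler_pM2r ?invr_gt0 // ler_nat.
    apply: min_propagates (IH (ltnW jM)) _ _ _.
    - by rewrite /unit_ball /= nZ // (le_lt_trans _ (Bp : enorm p < 1)) // ler_piMl // (le_trans jj).
    - by rewrite lZ mulf_neq0 // gt_eqF.
    - rewrite !lZ mulrACA; apply: mulr_ge0; first by apply: mulr_ge0 => //; exact: ltW.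
      by rewrite -expr2 sqr_ge0.
    - rewrite -scalerBl enormZ nZ ?ltW //.
      have -> : j%:R / M.+1%:R - j.+1%:R / M.+1%:R = - (M.+1%:R)^-1 :> R.
        by rewrite -mulrBl -[j.+1%:R]natr1 opprD addNKr mulN1r.
      rewrite normrN gtr0_norm ?invr_gt0 //.
      rewrite (@lt_le_trans _ _ (1 - enorm p)) //.
        by rewrite mulrC ltr_pdivrMr // mulrC -ltr_pdivrMr.
      by rewrite lerD2l lerN2 ler_piMl.
  by have := chain M.+1 (leqnn _); rewrite divff ?gt_eqF // scale1r.
move=> p Bp; have [p0|] := eqVneq (last_coord p) 0; last exact: off.
apply/eqP; rewrite eq_le u_ge // andbT -lerN2.
apply: (@line_limit_ge _ _ (fun x => - u x) p (evec R ord_max) _ (1 - enorm p)).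
- by rewrite subr_gt0.
- by apply: continuousN; exact: cu.
move=> t /andP[t0 t1]; rewrite off //.
  rewrite /unit_ball /=; have := ler_enormD (t *: evec R ord_max) p.
  rewrite enormZ enorm_evec mulr1 gtr0_norm //; lra.
by rewrite last_coordD p0 addr0 last_coord_evec mulr1 gt_eqF.
Qed.

End strong_minimum.

(** * The minimum principle *)

Lemma holder_continuous (R : realType) (n : nat) (gamma : R) (A : set 'rV[R]_n)
    (f : 'rV[R]_n -> R) :
  0 < gamma -> holder_on gamma A f -> {within A, continuous f}.
Proof.
move=> g0 [C fC]; apply/subspace_continuousP => x Ax.
apply/cvgrPdist_lt => e e0; rewrite near_withinE.
pose d := (e / (`|C| + 1)) `^ gamma^-1.
have C1 : 0 < `|C| + 1 by rewrite ltr_wpDl.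
have d0 : 0 < d by rewrite powR_gt0 // divr_gt0.
have : \forall y \near x, enorm (x - y) < d.
  have cn : {for x, continuous (fun y : 'rV[R]_n => enorm (x - y))}.
    apply: (@continuous_comp _ _ _ (fun y : 'rV[R]_n => x - y));
      last exact: enorm_continuous.
    by apply: continuousB; [exact: cst_continuous|].
  have /cvgr_lt := cn; apply.
  by rewrite subrr -(scale0r 0) enormZ normr0 mul0r.
apply: filterS => y yd Ay.
rewrite (le_lt_trans (fC x y Ax Ay)) //.
have h : enorm (x - y) `^ gamma < e / (`|C| + 1).
  have <- : d `^ gamma = e / (`|C| + 1).
    by rewrite /d -powRrM mulVf ?lt0r_neq0 // powRr1 // divr_ge0 // ltW.
  by apply: (gt0_ltr_powR g0 _ _ yd); rewrite nnegrE; [exact: enorm_ge0|exact: ltW].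
rewrite (@le_lt_trans _ _ (`|C| * enorm (x - y) `^ gamma)) //.
  by apply: ler_wpM2r; [exact: powR_ge0|exact: ler_norm].
rewrite (@le_lt_trans _ _ ((`|C| + 1) * enorm (x - y) `^ gamma)) //.
  by apply: ler_wpM2r; [exact: powR_ge0|rewrite lerDl].
by rewrite mulrC -ltr_pdivlMr.
Qed.

Theorem proposition3p2 (R : realType) (n : nat) (alpha gamma : R)
    (u : 'rV[R]_n.+1 -> R) :
  (3 <= n.+1)%N ->
  1 / 2 < alpha ->
  0 < gamma -> gamma < 1 ->
  Ck_on 2 (unit_ball R n.+1 `\` [set x | last_coord x = 0]) u ->
  holder_on gamma (closed_unit_ball R n.+1) u ->
  weak_supersolution alpha (unit_ball R n.+1) u ->
  ~ (exists c : R, forall x, unit_ball R n.+1 x -> u x = c) ->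
  exists2 m : R, is_min u (unit_sphere R n.+1) m &
    forall x, unit_ball R n.+1 x -> m < u x.
Proof.
move=> _ alpha_gt gamma0 _ C2u hu weak nconst.
have Lu x := weak_supersolution_pointwise C2u (x := x) weak.
have cu := holder_continuous gamma0 hu.
have BC : unit_ball R n.+1 `<=` closed_unit_ball R n.+1 by move=> x /ltW.
have cuB x : unit_ball R n.+1 x -> {for x, continuous u}.
  move=> Bx; have := continuous_subspaceW BC cu.
  by rewrite continuous_open_subspace; [apply; exact: mem_set|exact: open_unit_ball].
have clB : closed (closed_unit_ball R n.+1).
  apply: (@closed_comp _ _ (@enorm R n.+1) [set t | t <= 1]); last exact: closed_le.
  by move=> x _; exact: enorm_continuous.
have cB : compact (closed_unit_ball R n.+1).
  by apply: subclosed_compact clB (@cube_compact R n.+1 0 1) _ => x; exact: enorm_cube.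
have [c /set_mem Bc cmin] : exists2 c, c \in closed_unit_ball R n.+1 &
    forall t, t \in closed_unit_ball R n.+1 -> u c <= u t.
  apply: EVT_min_rV => //; exists 0.
  by rewrite /closed_unit_ball /= -(scale0r 0) enormZ normr0 mul0r.
have {}cmin x : closed_unit_ball R n.+1 x -> u c <= u x.
  by move=> Bx; apply: cmin; exact: mem_set.
have u_gt x : unit_ball R n.+1 x -> u c < u x.
  move=> Bx; rewrite lt_neqAle cmin ?andbT; last exact: BC.
  apply/eqP => ucx; apply: nconst; exists (u c).
  apply: (strong_minimum_principle C2u alpha_gt Lu cuB _ Bx) => // y /BC; exact: cmin.
exists (u c) => //; split.
  exists c => //; rewrite /unit_sphere /=; apply/eqP; rewrite eq_le Bc /= leNgt.
  by apply/negP => /u_gt; rewrite ltxx.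
by move=> _ [x Sx <-]; apply: cmin; rewrite /closed_unit_ball /= Sx.
Qed.
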